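(* Let $T=\begin{bmatrix}T_1&\cdots&T_d\end{bmatrix}$ (on a Hilbert space $\mathcal X$) and $R=\begin{bmatrix}R_1&\cdots&R_d\end{bmatrix}$ (on a Hilbert space $\widetilde{\mathcal X}$) be two strongly closely connected commutative row contractions, and assume that the associated characteristic function/Agler decomposition pairs $(\theta_T,\mathbb K_T)$ and $(\theta_R,\mathbb K_R)$ jointly coincide, i.e. there are unitary operators $\alpha:\mathcal D_{R^*}\to\mathcal D_{T^*}$ and $\beta:\mathcal D_R\to\mathcal D_T$ such that for all $z,\zeta\in\mathbb B^d$ $$\theta_T(z)=\alpha\,\theta_R(z)\,\beta^*,\qquad \mathbb K_T(z,\zeta)=\begin{bmatrix}\alpha&0\\ 0&\bigoplus_1^d\beta\end{bmatrix}\mathbb K_R(z,\zeta)\begin{bmatrix}\alpha^*&0\\ 0&\bigoplus_1^d\beta^*\end{bmatrix}.$$ Then $T$ and $R$ are unitarily equivalent, i.e. there is a unitary $U:\widetilde{\mathcal X}\to\mathcal X$ with $T_i=UR_iU^*$ for $i=1,\dots,d$.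
   Context: All spaces are complex Hilbert spaces; $\mathbb B^d$ is the open unit ball of $\mathbb C^d$; $Z_{\mathcal X}(z)=\begin{bmatrix}z_1I_{\mathcal X}&\cdots&z_dI_{\mathcal X}\end{bmatrix}:\mathcal X^d\to\mathcal X$; $\mathcal I_i:\mathcal X\to\mathcal X^d$ is the inclusion into the $i$-th slot. A commutative row contraction on $\mathcal X$ is a tuple of commuting operators $T_1,\dots,T_d\in\mathcal L(\mathcal X)$ such that $T=\begin{bmatrix}T_1&\cdots&T_d\end{bmatrix}:\mathcal X^d\to\mathcal X$ satisfies $\|T\|\le1$. Put $D_T=(I_{\mathcal X^d}-T^*T)^{1/2}$, $\mathcal D_T=\overline{\operatorname{Ran}}\,D_T\subset\mathcal X^d$, $D_{T^*}=(I_{\mathcal X}-TT^* )^{1/2}$, $\mathcal D_{T^*}=\overline{\operatorname{Ran}}\,D_{T^*}\subset\mathcal X$. The characteristic function is $\theta_T(z)=\big(-T+D_{T^*}(I_{\mathcal X}-Z_{\mathcal X}(z)T^* )^{-1}Z_{\mathcal X}(z)D_T\big)|_{\mathcal D_T}:\mathcal D_T\to\mathcal D_{T^*}$, $z\in\mathbb B^d$. The associated Agler decomposition is the kernel $$\mathbb K_T(z,\zeta)=\mathbb G_T(z)\mathbb G_T(\zeta)^*,\qquad\mathbb G_T(z)=\begin{bmatrix}D_{T^*}(I_{\mathcal X}-Z_{\mathcal X}(z)T^* )^{-1}\\ D_T(I_{\mathcal X^d}-Z_{\mathcal X}(z)^*T)^{-1}\mathcal I_1\\ \vdots\\ D_T(I_{\mathcal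 X^d}-Z_{\mathcal X}(z)^*T)^{-1}\mathcal I_d\end{bmatrix}:\mathcal X\to\mathcal D_{T^*}\oplus\mathcal D_T^{\,d}.$$ $T$ is strongly closely connected (strongly c.c.) if $\mathcal M_T^{(2)}=\{0\}$, where $$\mathcal M_T^{(2)}=\{x\in\mathcal X: D_{T^*}(I_{\mathcal X}-Z_{\mathcal X}(z)T^* )^{-1}x\equiv0\ \text{and}\ D_T(I_{\mathcal X^d}-Z_{\mathcal X}(z)^*T)^{-1}Z_{\mathcal X}(z)^*x\equiv0\ \text{on }\mathbb B^d\}.$$ *)

(* Defs.v *)
From HB Require Import structures.
From mathcomp Require Import all_boot all_order all_algebra.
From mathcomp Require Import all_classical reals topology normedtype.
From mathcomp Require Export complex.

Set Implicit Arguments.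
Unset Strict Implicit.
Unset Printing Implicit Defensive.

Import Order.TTheory GRing.Theory Num.Theory Num.Def.
Import numFieldNormedType.Exports.

Local Open Scope classical_set_scope.
Local Open Scope ring_scope.

(* Inner products are linear in the first variable and conjugate-linear in the
   second one. *)
HB.mixin Record NormedModule_hasInner (C : numClosedFieldType) V
    & NormedModule C V := {
  inner : {dot V for @conjC C};
  norm_innerE : forall x : V, `|x| = sqrtC (inner x x)
}.

#[short(type="preHilbertType")]
HB.structure Definition PreHilbert (C : numClosedFieldType) :=
  {V of NormedModule C V & NormedModule_hasInner C V}.

#[short(type="hilbertType")]
HB.structure Definition Hilbert (C : numClosedFieldType) :=
  {V of CompleteNormedModule C V & PreHilbert C V}.

Notation "''[' u , v ]" := (inner u%R v%R) : ring_scope.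

HB.factory Record Lmodule_hasInner (C : numClosedFieldType) V
    & GRing.Lmodule C V := {
  dot_form : {dot V for @conjC C}
}.

HB.builders Context C V & Lmodule_hasInner C V.

Local Notation f := dot_form.

Let norm (x : V) : C := sqrtC (f x x).

Let normK x : norm x ^+ 2 = f x x.
Proof. exact: sqrtCK. Qed.

Let norm_ge0 x : 0 <= norm x.
Proof. by rewrite sqrtC_ge0 dnorm_ge0. Qed.

Let CauchySchwarz (x y : V) : `|f x y| <= norm x * norm y.
Proof.
have [->|y0] := eqVneq y 0.
  by rewrite linear0r normr0 mulr_ge0.
rewrite -[leLHS](sqrCK (normr_ge0 _)) /norm -sqrtCM ?nnegrE ?dnorm_ge0//.
rewrite ler_sqrtC ?nnegrE ?mulr_ge0 ?dnorm_ge0 ?exprn_ge0//.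
have fy : 0 < f y y by rewrite dnorm_gt0.
pose a := f x y / f y y.
have := dnorm_ge0 f (x - a *: y).
rewrite dnormB dnormZ linearZr_LR/= /a.
have fyR : (f y y)^* = f y y by apply: conj_Creal; rewrite ger0_real ?ltW.
have -> : (f x y / f y y)^* * f x y = `|f x y| ^+ 2 / f y y.
  by rewrite rmorphM/= fmorphV/= fyR normCK mulrAC [X in X / _]mulrC.
rewrite normrM exprMn normfV (gtr0_norm fy).
have -> : (`|f x y| ^+ 2 / f y y)^* = `|f x y| ^+ 2 / f y y.
  apply: conj_Creal; apply: ger0_real.
  by rewrite divr_ge0 ?exprn_ge0// ltW.
have -> : f x x + `|f x y| ^+ 2 * (f y y)^-1 ^+ 2 * f y y -
   (`|f x y| ^+ 2 / f y y + `|f x y| ^+ 2 / f y y) =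
   f x x - `|f x y| ^+ 2 / f y y.
  rewrite expr2 -!mulrA mulVf ?gt_eqF// mulr1 opprD addrA.
  by rewrite addrK.
by rewrite subr_ge0 ler_pdivrMr.
Qed.

Let ler_normD (x y : V) : norm (x + y) <= norm x + norm y.
Proof.
rewrite -ler_sqr ?nnegrE ?addr_ge0// sqrrD !normK dnormD/=.
rewrite addrAC lerD2r lerD2l.
have -> : f x y + (f x y)^* = 2 * 'Re (f x y).
  by rewrite ReE mulrCA divff ?mulr1 ?pnatr_eq0.
rewrite -[leRHS]mulr_natl ler_wpM2l ?ler0n//.
by apply: le_trans (CauchySchwarz x y); exact: (leif_Re_Creal (f x y)).
Qed.

Let normrZ (a : C) (x : V) : norm (a *: x) = `|a| * norm x.
Proof. by rewrite /norm dnormZ sqrtCM ?nnegrE ?exprn_ge0 ?dnorm_ge0// sqrCK. Qed.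

Let normr0_eq0 (x : V) : norm x = 0 -> x = 0.
Proof. by move/eqP; rewrite sqrt_dnorm_eq0 => /eqP. Qed.

HB.instance Definition _ :=
  Lmodule_isNormed.Build C V ler_normD normrZ normr0_eq0.

HB.instance Definition _ :=
  NormedModule_hasInner.Build C V (fun x => erefl : `|x| = sqrtC (f x x)).

HB.end.

Section Completeness.
Variable C : numClosedFieldType.

Lemma cauchy_short (V W : normedModType C) (g : V -> W) :
  (forall x y, `|g x - g y| <= `|x - y|) ->
  forall F : set_system V, ProperFilter F -> cauchy F -> cauchy (g @ F).
Proof.
move=> gle F FF /cauchy_ballP Fc; apply/cauchy_ballP => e e0.
near_simpl; have := Fc e e0; near_simpl => Fe.
apply: filterS Fe => -[x y]; rewrite -!ball_normE /=.
by apply: le_lt_trans; exact: gle.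
Qed.

End Completeness.

(* Orthogonal direct sum X (+) Y; an alias of X * Y, on which the library
   already puts the max norm. *)
Definition hsum (X Y : Type) : Type := (X * Y)%type.

Section DirectSum.
Variable C : numClosedFieldType.

HB.instance Definition _ (X Y : lmodType C) :=
  GRing.Lmodule.copy (hsum X Y) (X * Y)%type.

Variables X Y : hilbertType C.

Definition hsum_inner (u v : hsum X Y) : C := '[u.1, v.1] + '[u.2, v.2].

Fact hsum_inner_bilinear : bilinear_for *%R (conjC \; *%R) hsum_inner.
Proof.
split=> [u' a u v|u a u' v]; rewrite /hsum_inner /=.
  by rewrite !linearPl/= mulrDr addrACA.
by rewrite !linearPr/= mulrDr addrACA.
Qed.

HB.instance Definition _ := bilinear_isBilinear.Build C (hsum X Y) (hsum X Y) C
  *%R (conjC \; *%R) hsum_inner hsum_inner_bilinear.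

Fact hsum_inner_herm u v :
  hsum_inner u v = (-1) ^+ false * conjC (hsum_inner v u).
Proof.
by rewrite mul1r rmorphD/= /hsum_inner; congr (_ + _);
  rewrite [LHS]hermC mul1r.
Qed.

HB.instance Definition _ := isHermitianSesquilinear.Build C (hsum X Y) false
  conjC hsum_inner hsum_inner_herm.

Fact hsum_inner_gt0 u : u != 0 -> 0 < hsum_inner u u.
Proof.
move=> u0; rewrite lt_def addr_ge0 ?dnorm_ge0// andbT.
rewrite paddr_eq0 ?dnorm_ge0// !dnorm_eq0.
by apply: contra u0; case: u => a b /=.
Qed.

HB.instance Definition _ := isDotProduct.Build C (hsum X Y)
  hsum_inner hsum_inner_gt0.

HB.instance Definition _ := Lmodule_hasInner.Build C (hsum X Y) hsum_inner.

Lemma hsum_norm (u : hsum X Y) : `|u| ^+ 2 = `|u.1| ^+ 2 + `|u.2| ^+ 2.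
Proof. by rewrite !norm_innerE !sqrtCK. Qed.

Fact hsum_complete (F : set_system (hsum X Y)) :
  ProperFilter F -> cauchy F -> cvg F.
Proof.
move=> FF Fc.
have n1 (u : hsum X Y) : `|u.1| <= `|u|.
  by rewrite -ler_sqr ?nnegrE// hsum_norm lerDl exprn_ge0.
have n2 (u : hsum X Y) : `|u.2| <= `|u|.
  by rewrite -ler_sqr ?nnegrE// hsum_norm lerDr exprn_ge0.
have /cauchy_cvg/cvg_ex[l1 Fl1] := @cauchy_short _ _ _ (fun u : hsum X Y => u.1)
  (fun u v => n1 (u - v)) F FF Fc.
have /cauchy_cvg/cvg_ex[l2 Fl2] := @cauchy_short _ _ _ (fun u : hsum X Y => u.2)
  (fun u v => n2 (u - v)) F FF Fc.
apply/cvg_ex; exists ((l1, l2) : hsum X Y).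
apply/cvgrPdist_lt => e e0.
have e20 : 0 < e / 2 by rewrite divr_gt0.
move/cvgrPdist_lt : Fl1 => /(_ _ e20) F1.
move/cvgrPdist_lt : Fl2 => /(_ _ e20) F2.
near=> u.
have : `|l1 - u.1| + `|l2 - u.2| < e.
  by rewrite [e]splitr ltrD//; near: u.
apply: le_lt_trans; rewrite -ler_sqr ?nnegrE ?addr_ge0// hsum_norm/=.
by rewrite sqrrD addrAC lerDl mulrn_wge0// mulr_ge0.
Unshelve. all: by end_near. Qed.

HB.instance Definition _ := Uniform_isComplete.Build (hsum X Y) hsum_complete.

End DirectSum.

Section FinitePower.
Variables (C : numClosedFieldType) (I : finType) (X : hilbertType C).

Definition ffun_inner (u v : {ffun I -> X}) : C := \sum_i '[u i, v i].

Fact ffun_inner_bilinear : bilinear_for *%R (conjC \; *%R) ffun_inner.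
Proof.
split=> [u' a u v|u a u' v]; rewrite /ffun_inner /=.
  rewrite mulr_sumr -big_split/=; apply: eq_bigr => i _.
  by rewrite !ffunE linearPl.
rewrite mulr_sumr -big_split/=; apply: eq_bigr => i _.
by rewrite !ffunE linearPr.
Qed.

HB.instance Definition _ := bilinear_isBilinear.Build C
  {ffun I -> X} {ffun I -> X} C
  *%R (conjC \; *%R) ffun_inner ffun_inner_bilinear.

Fact ffun_inner_herm u v :
  ffun_inner u v = (-1) ^+ false * conjC (ffun_inner v u).
Proof.
rewrite mul1r rmorph_sum/=; apply: eq_bigr => i _.
by rewrite [LHS]hermC mul1r.
Qed.

HB.instance Definition _ := isHermitianSesquilinear.Build C {ffun I -> X} false
  conjC ffun_inner ffun_inner_herm.

Fact ffun_inner_gt0 u : u != 0 -> 0 < ffun_inner u u.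
Proof.
move=> u0; rewrite lt_def sumr_ge0 ?andbT => [|i _]; last exact: dnorm_ge0.
apply: contra u0; rewrite psumr_eq0 => [/allP /= u0|i _]; last exact: dnorm_ge0.
apply/eqP/ffunP => i; rewrite ffunE; apply/eqP.
by rewrite -(dnorm_eq0 inner) u0// mem_index_enum.
Qed.

HB.instance Definition _ := isDotProduct.Build C {ffun I -> X}
  ffun_inner ffun_inner_gt0.

HB.instance Definition _ := Lmodule_hasInner.Build C {ffun I -> X} ffun_inner.

Lemma ffun_norm (u : {ffun I -> X}) : `|u| ^+ 2 = \sum_i `|u i| ^+ 2.
Proof.
by rewrite norm_innerE sqrtCK; apply: eq_bigr => i _; rewrite norm_innerE sqrtCK.
Qed.

Fact ffun_complete (F : set_system {ffun I -> X}) :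
  ProperFilter F -> cauchy F -> cvg F.
Proof.
move=> FF Fc.
have ni i (u : {ffun I -> X}) : `|u i| <= `|u|.
  rewrite -ler_sqr ?nnegrE// ffun_norm (bigD1 i)//= lerDl sumr_ge0// => j _.
  exact: exprn_ge0.
have Fi i : exists l : X, (fun u : {ffun I -> X} => u i) @ F --> l.
  suff /cauchy_cvg/cvg_ex : cauchy ((fun u : {ffun I -> X} => u i) @ F) by [].
  apply: (@cauchy_short _ _ _ (fun u : {ffun I -> X} => u i)) => // u v.
  by have := ni i (u - v); rewrite !ffunE.
have /choice[l Fl] := Fi.
apply/cvg_ex; exists [ffun i => l i].
apply/cvgrPdist_lt => e e0.
have d0 : 0 < e / #|I|.+1%:R by rewrite divr_gt0 ?ltr0n.
have : \forall u \near F, forall i, `|l i - (u : {ffun I -> X}) i| < e / #|I|.+1%:R.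
  apply: filter_forall => i.
  by move/cvgrPdist_lt : (Fl i) => /(_ _ d0).
apply: filterS => u lu.
apply: (@le_lt_trans _ _ (\sum_i `|l i - u i|)).
  rewrite -ler_sqr ?nnegrE ?sumr_ge0// ffun_norm.
  under eq_bigr do rewrite !ffunE.
  rewrite [leRHS]expr2 mulr_suml ler_sum// => i _.
  by rewrite expr2 ler_wpM2l// (bigD1 i)//= lerDl sumr_ge0.
apply: (@le_lt_trans _ _ (\sum_(i : I) e / #|I|.+1%:R)).
  by apply: ler_sum => i _; exact/ltW.
rewrite sumr_const -[ltLHS]mulr_natr mulrAC ltr_pdivrMr ?ltr0n//.
by rewrite ltr_pM2l// ltr_nat.
Qed.

HB.instance Definition _ :=
  Uniform_isComplete.Build {ffun I -> X} ffun_complete.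

End FinitePower.

Record closedSubspace (C : numClosedFieldType) (X : hilbertType C) :=
  ClosedSubspace {
    csub_set : set X;
    csub_set0 : csub_set 0;
    csub_setP : forall a u v,
      csub_set u -> csub_set v -> csub_set (a *: u + v);
    csub_closed : closed csub_set
  }.

Section ClosedSubspaceType.
Variables (C : numClosedFieldType) (X : hilbertType C) (S : closedSubspace X).

Definition csub_pred : {pred X} := fun x => `[< csub_set S x >].

Fact csub_pred_submod : submod_closed csub_pred.
Proof.
split; first exact/asboolP/csub_set0.
by move=> a u v /asboolP Su /asboolP Sv; apply/asboolP/csub_setP.
Qed.

HB.instance Definition _ :=
  GRing.isSubmodClosed.Build C X csub_pred csub_pred_submod.

Record csub := CSub { csub_val : X; csub_valP : csub_val \in csub_pred }.

HB.instance Definition _ := [isSub for csub_val].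
HB.instance Definition _ := [Choice of csub by <:].
HB.instance Definition _ := [SubChoice_isSubLmodule of csub by <:].

Definition csub_inner (u v : csub) : C := '[csub_val u, csub_val v].

Fact csub_inner_bilinear : bilinear_for *%R (conjC \; *%R) csub_inner.
Proof.
split=> [u' a u v|u a u' v]; rewrite /csub_inner.
  by rewrite [csub_val _](linearP (val : csub -> X)) linearPl.
by rewrite [csub_val (_ + _)](linearP (val : csub -> X)) linearPr.
Qed.

HB.instance Definition _ := bilinear_isBilinear.Build C csub csub C
  *%R (conjC \; *%R) csub_inner csub_inner_bilinear.

Fact csub_inner_herm u v :
  csub_inner u v = (-1) ^+ false * conjC (csub_inner v u).
Proof. exact: hermC. Qed.

HB.instance Definition _ := isHermitianSesquilinear.Build C csub false
  conjC csub_inner csub_inner_herm.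

Fact csub_inner_gt0 u : u != 0 -> 0 < csub_inner u u.
Proof.
move=> u0; rewrite dnorm_gt0; apply: contra u0 => /eqP u0.
by apply/eqP/val_inj; rewrite /= u0 [RHS](linear0 (val : csub -> X)).
Qed.

HB.instance Definition _ := isDotProduct.Build C csub
  csub_inner csub_inner_gt0.

HB.instance Definition _ := Lmodule_hasInner.Build C csub csub_inner.

Lemma csub_norm (u : csub) : `|u| = `|csub_val u|.
Proof. by rewrite !norm_innerE. Qed.

Fact csub_complete (F : set_system csub) :
  ProperFilter F -> cauchy F -> cvg F.
Proof.
move=> FF Fc.
have vB u v : csub_val u - csub_val v = csub_val (u - v).
  by rewrite [RHS](linearB (val : csub -> X)).
have /cauchy_cvg/cvg_ex[l Fl] : cauchy (csub_val @ F).
  by apply: (@cauchy_short _ _ _ csub_val _ F) => // u v; rewrite vB csub_norm.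
have Sl : l \in csub_pred.
  apply/asboolP; apply: (closed_cvg (csub_set S) (@csub_closed _ _ S)) Fl.
  by apply: nearW => u; exact/asboolP/csub_valP.
apply/cvg_ex; exists (CSub Sl); apply/cvgrPdist_lt => e e0.
move/cvgrPdist_lt : Fl => /(_ _ e0); apply: filterS => u.
by rewrite csub_norm -vB.
Qed.

HB.instance Definition _ := Uniform_isComplete.Build csub csub_complete.

End ClosedSubspaceType.


Section Operators.
Variable C : numClosedFieldType.
Implicit Types X Y : hilbertType C.

Definition bounded_op X Y (A : X -> Y) : Prop :=
  exists M : C, forall x, `|A x| <= M * `|x|.

(* The adjoint of A: for bounded linear A, the Riesz theorem provides a unique
   vector satisfying the condition for every y. *)
Definition adj X Y (A : X -> Y) (y : Y) : X :=
  xget 0 [set x | forall x', '[A x', y] = '[x', x]].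

(* The inverse of A when A is bijective; unspecified otherwise. *)
Definition inv_op X Y (A : X -> Y) (y : Y) : X := xget 0 [set x | A x = y].

(* The positive square root of a positive bounded operator. As scalars are
   complex, 0 <= '[B x, x] includes that '[B x, x] is real, hence that B is
   self-adjoint. *)
Definition sqrt_op X (A : X -> X) : X -> X :=
  xget (fun=> 0) [set B : X -> X |
    [/\ linear B, bounded_op B, forall x, 0 <= '[B x, x] & B \o B = A]].

Fact sqrt_op_linear X (A : X -> X) : linear (sqrt_op A).
Proof.
rewrite /sqrt_op; case: xgetP => [B _ [] //|_] a u v.
by rewrite scaler0 addr0.
Qed.

HB.instance Definition _ X (A : X -> X) :=
  GRing.isLinear.Build C X X *:%R (sqrt_op A) (@sqrt_op_linear X A).

Definition unitary X Y (U : {linear X -> Y}) : Prop :=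
  [/\ bounded_op U, adj U \o U = id & U \o adj U = id].

Section ClosedRange.
Variables (X Y : hilbertType C) (A : {linear X -> Y}).

Local Notation S := (closure (range A)).

Let S0 : S 0.
Proof. by apply: subset_closure; exists 0 => //; rewrite linear0. Qed.

Let SP a u v : S u -> S v -> S (a *: u + v).
Proof.
move=> Su Sv B /nbhs_ballP[e /= e0 eB].
have k0 : 0 < e / 2 / (`|a| + 1) by rewrite !divr_gt0// ltr_wpDl.
have e20 : 0 < e / 2 by rewrite divr_gt0.
have [_ [[x _ <-] /=]] := Su _ (nbhsx_ballx u _ k0).
have [_ [[y _ <-] /=]] := Sv _ (nbhsx_ballx v _ e20).
rewrite -!ball_normE /= => vy ux; exists (A (a *: x + y)); split.
  by exists (a *: x + y).
apply: eB; rewrite -ball_normE /= linearP opprD addrACA -scalerBr [e]splitr.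
apply: le_lt_trans (ler_normD _ _) _; rewrite ler_ltD// normrZ.
rewrite ltr_pdivlMr ?ltr_wpDl// in ux.
by apply: le_trans (ltW ux); rewrite mulrC ler_wpM2l// lerDl.
Qed.

Definition closed_range : closedSubspace Y :=
  @ClosedSubspace C Y S S0 SP (@closed_closure _ _).

Fact range_csub x : A x \in csub_pred closed_range.
Proof. by apply/asboolP; apply: subset_closure; exists x. Qed.

Definition to_closed_range (x : X) : csub closed_range := CSub (range_csub x).

End ClosedRange.

Definition hsum_map d X Y X' Y' (a : X -> X') (b : Y -> Y')
    (u : hsum X {ffun 'I_d -> Y}) : hsum X' {ffun 'I_d -> Y'} :=
  (a u.1, [ffun i => b (u.2 i)]).

End Operators.

Definition unit_ball (C : numClosedFieldType) (d : nat) : set ('I_d -> C) :=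
  [set z | \sum_i `|z i| ^+ 2 < 1].

Section RowContraction.
Variables (C : numClosedFieldType) (d : nat) (X : hilbertType C).

Definition slot (i : 'I_d) (x : X) : {ffun 'I_d -> X} :=
  [ffun j => if j == i then x else 0].

Definition row_op (T : 'I_d -> {linear X -> X}) (u : {ffun 'I_d -> X}) : X :=
  \sum_i T i (u i).

Definition Zrow (z : 'I_d -> C) (u : {ffun 'I_d -> X}) : X :=
  \sum_i z i *: u i.

Variable T : 'I_d -> {linear X -> X}.

Definition commutative_row_contraction : Prop :=
  [/\ forall i, bounded_op (T i),
      forall i j, T i \o T j = T j \o T i :> (X -> X)
    & forall u, `|row_op T u| <= `|u|].

Definition row_adj : X -> {ffun 'I_d -> X} := adj (row_op T).

Definition defect : {linear {ffun 'I_d -> X} -> {ffun 'I_d -> X}} :=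
  sqrt_op (fun u => u - row_adj (row_op T u)).

Definition codefect : {linear X -> X} :=
  sqrt_op (fun x => x - row_op T (row_adj x)).

Definition defect_space : hilbertType C := csub (closed_range defect).
Definition codefect_space : hilbertType C := csub (closed_range codefect).

Definition resolvent (z : 'I_d -> C) : X -> X :=
  inv_op (fun x => x - Zrow z (row_adj x)).
Definition coresolvent (z : 'I_d -> C) : {ffun 'I_d -> X} -> {ffun 'I_d -> X} :=
  inv_op (fun u => u - adj (Zrow z) (row_op T u)).

(* [insubd 0] only restricts the codomain: the vector it is applied to lies in
   the closure of the range of D_{T^*}, because T D_T = D_{T^*} T. *)
Definition char_fun (z : 'I_d -> C) (v : defect_space) : codefect_space :=
  insubd (0 : csub (closed_range codefect))
    (- row_op T (val v) + codefect (resolvent z (Zrow z (defect (val v))))).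

Definition agler_G (z : 'I_d -> C) (x : X) :
    hsum codefect_space {ffun 'I_d -> defect_space} :=
  (to_closed_range codefect (resolvent z x),
   [ffun i => to_closed_range defect (coresolvent z (slot i x))]).

Definition agler_K (z w : 'I_d -> C) :
    hsum codefect_space {ffun 'I_d -> defect_space} ->
    hsum codefect_space {ffun 'I_d -> defect_space} :=
  agler_G z \o adj (agler_G w).

Definition scc_kernel : set X :=
  [set x | (forall z, unit_ball z -> codefect (resolvent z x) = 0) /\
    (forall z, unit_ball z ->
       defect (coresolvent z (adj (Zrow z) x)) = 0)].

Definition strongly_closely_connected : Prop := scc_kernel = [set 0].

End RowContraction.

Arguments char_fun {C d X} T.
Arguments agler_K {C d X} T.

(* Main.v *)
(* Expanding the Gram matrix of the vectors [G_T(w)^* u], the coincidence of the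
   Agler kernels says that [G_S(w)^* (alpha (+) beta^d)^* u |-> G_T(w)^* u]
   preserves inner products.  Strong close connectedness makes both families
   total, so this map is induced by a unitary [U] with
   [G_T(z) U = (alpha (+) beta^d) G_S(z)].  At [z = 0] this reads
   [D_T^* U = alpha D_S^*] and [D_T U^d = beta D_S], whence
   [T^* T U^d = U^d S^* S]; with [theta_T(0) beta = alpha theta_S(0)] it also
   gives [D_T^* T U^d = D_T^* U S].  Expanding the two resolvents once then puts
   the range of [T U^d - U S] inside [M_T^(2) = 0]. *)
Require Import Defs.
From HB Require Import structures.
From mathcomp Require Import all_boot all_order all_algebra.
From mathcomp Require Import all_classical reals topology normedtype complex.
From mathcomp Require Import sequences ring lra.

Set Implicit Arguments.
Unset Strict Implicit.
Unset Printing Implicit Defensive.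

Import Order.TTheory GRing.Theory Num.Theory Num.Def.
Import numFieldNormedType.Exports.

Local Open Scope classical_set_scope.
Local Open Scope ring_scope.

(** Adjoint, inverse and square root are choices with a default value, so nothing can be computed
    before each is shown to exist and to be unique: Riesz representation gives the adjoints, the
    Neumann series the resolvents, and an iteration the defects. The iteration reaches the root of
    [1 - A] as a limit of polynomials in [A], so that both [T D_T = D_{T^*} T] and the uniqueness of
    the root follow by passing to the limit. In [D_{T^*} T U^d = D_{T^*} U S] the factor [D_{T^*}]
    cannot simply be cancelled: it may have a kernel, and it is zero for a row coisometry. This is
    why the argument has to end in [M_T^(2)]. *)

Section LinearMaps.
Variables (C : numClosedFieldType) (V W : lmodType C) (f : V -> W).
Hypothesis fl : linear f.

Let F : {linear V -> W} :=
  HB.pack_for {linear V -> W} f (GRing.isLinear.Build C V W *:%R f fl).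

(** Operators obtained by choice or as limits are bare functions whose linearity is a theorem, so it
    enters here as a hypothesis. *)
Lemma linear_funB x y : f (x - y) = f x - f y.
Proof. exact: (linearB F). Qed.

Lemma linear_funD x y : f (x + y) = f x + f y.
Proof. exact: (linearD F). Qed.

Lemma linear_funN x : f (- x) = - f x.
Proof. exact: (linearN F). Qed.

Lemma linear_fun0 : f 0 = 0.
Proof. exact: (linear0 F). Qed.

Lemma linear_funZ a x : f (a *: x) = a *: f x.
Proof. exact: (linearZ_LR F). Qed.

Lemma linear_fun_sum (I : finType) (E : I -> V) :
  f (\sum_i E i) = \sum_i f (E i).
Proof. exact: (linear_sum F). Qed.

End LinearMaps.

(** * Inner product calculus and the Cauchy-Schwarz inequality *)

Section InnerProduct.
Variables (C : numClosedFieldType) (X : hilbertType C).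
Implicit Types (x y z : X) (a : C).

Lemma innerC x y : '[x, y] = ('[y, x])^*.
Proof. by rewrite [LHS]hermC mul1r. Qed.

Lemma innerDl x y z : '[x + y, z] = '[x, z] + '[y, z].
Proof. exact: linearDl. Qed.

Lemma innerDr x y z : '[x, y + z] = '[x, y] + '[x, z].
Proof. exact: linearDr. Qed.

Lemma innerBl x y z : '[x - y, z] = '[x, z] - '[y, z].
Proof. exact: linearBl. Qed.

Lemma innerBr x y z : '[x, y - z] = '[x, y] - '[x, z].
Proof. exact: linearBr. Qed.

Lemma innerNl x z : '[- x, z] = - '[x, z].
Proof. exact: linearNl. Qed.

Lemma innerNr x z : '[x, - z] = - '[x, z].
Proof. exact: linearNr. Qed.

Lemma innerZl a x z : '[a *: x, z] = a * '[x, z].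
Proof. exact: linearZl_LR. Qed.

Lemma innerZr a x z : '[x, a *: z] = a^* * '[x, z].
Proof. exact: linearZr_LR. Qed.

Lemma inner0l x : '[0, x] = 0.
Proof. exact: linear0l. Qed.

Lemma inner0r x : '[x, 0] = 0.
Proof. exact: linear0r. Qed.

Lemma norm_sqr x : `|x| ^+ 2 = '[x, x].
Proof. by rewrite norm_innerE sqrtCK. Qed.

Lemma inner_ge0 x : 0 <= '[x, x].
Proof. by rewrite -norm_sqr exprn_ge0. Qed.

Lemma inner_eq0 x : '[x, x] = 0 -> x = 0.
Proof. by move=> /eqP; rewrite -norm_sqr sqrf_eq0 normr_eq0 => /eqP. Qed.

Lemma inner_inj x y : (forall z, '[z, x] = '[z, y]) -> x = y.
Proof.
move=> h; apply/eqP; rewrite -subr_eq0; apply/eqP/inner_eq0.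
by rewrite innerBr h subrr.
Qed.

Lemma inner_le_norm x y : `|'[x, y]| <= `|x| * `|y|.
Proof.
have [->|y0] := eqVneq y 0; first by rewrite inner0r !normr0 mulr0.
have n0 : 0 < `|y| ^+ 2 by rewrite exprn_gt0 // normr_gt0.
rewrite -ler_sqr ?nnegrE ?mulr_ge0 // exprMn -ler_pdivrMr //.
have := inner_ge0 (x - ('[x, y] / `|y| ^+ 2) *: y).
have nR : (`|y| ^+ 2)^* = `|y| ^+ 2.
  by apply: conj_Creal; rewrite ger0_real // exprn_ge0.
rewrite innerBl !innerBr !innerZl !innerZr -!norm_sqr rmorphM fmorphV /= nR.
rewrite (innerC y x).
set p := '[x, y]; set n := `|y| ^+ 2.
have -> : `|x| ^+ 2 - p^* / n * p - (p / n * p^* - p / n * (p^* / n * n)) =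
  `|x| ^+ 2 - p * p^* / n.
  by field; rewrite gt_eqF.
by rewrite -normCK subr_ge0.
Qed.

End InnerProduct.

(** * Real parts, dominated sequences, bounded operators *)

Section Sequences.
Variables (R : realType).
Local Notation C := R[i].
Implicit Types X Y : hilbertType C.

(** Norms live in [R[i]], whose order is only partial; suprema and infima are taken in [R] and
    carried back through real parts. *)
Lemma ger0_Re (a : C) : 0 <= a -> a = (complex.Re a)%:C%C.
Proof. by rewrite lecE; case: a => x y /= /andP[/eqP-> _]. Qed.

Lemma real_Re (a : C) : a \is Num.real -> a = (complex.Re a)%:C%C.
Proof.
by rewrite realE => /orP[/ger0_Re //|]; rewrite lecE; case: a => x y /= /andP[/eqP<- _].
Qed.

Lemma natSinv_lt (e : C) : 0 < e -> exists n : nat, n.+1%:R^-1 < e.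
Proof.
move=> e0; have eE := ger0_Re (ltW e0).
have r0 : 0 < complex.Re e by rewrite -ltcR -eE.
have [n nr] := @ltr_add_invr R 0 (complex.Re e) r0.
by exists n; rewrite eE; move: nr; rewrite add0r -ltcR fmorphV rmorph_nat.
Qed.

Lemma cauchy_seq_cvg X (u : nat -> X) :
  (forall e : C, 0 < e -> exists N, forall n m, (N <= n)%N -> (N <= m)%N ->
     `|u n - u m| < e) ->
  exists l : X, u @ \oo --> l.
Proof.
move=> uc; suff /cauchy_cvg/cvg_ex : cauchy (u @ \oo) by [].
apply/cauchy_ballP => e e0.
near_simpl; have [N uN] := uc e e0.
exists ([set n | (N <= n)%N], [set n | (N <= n)%N]).
  by split; exists N.
by move=> [n m] [/= Nn Nm]; rewrite -ball_normE /=; exact: uN.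
Qed.

(** The bound forces [r] to be nondecreasing, so it approaches its supremum, and the telescoped
    increments of [u] are dominated by those of [r]. *)
Lemma incr_dominated_cvg X (u : nat -> X) (r : nat -> R) (b : R) :
  (forall n, `|u n.+1 - u n| <= (r n.+1 - r n)%:C%C) ->
  (forall n, r n <= b) -> exists l : X, u @ \oo --> l.
Proof.
move=> ustep rb; apply: cauchy_seq_cvg => e e0.
have ur n m : (n <= m)%N -> `|u m - u n| <= (r m - r n)%:C%C.
  move=> nm; rewrite -(subnK nm); elim: (m - n)%N => [|k IH].
    by rewrite !subrr normr0.
  rewrite addSn -[u _](subrK (u (k + n)%N)) -addrA.
  apply: le_trans (ler_normD _ _) _; apply: le_trans (lerD (ustep _) IH) _.
  by rewrite -rmorphD addrA subrK.
have eE := ger0_Re (ltW e0).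
have e'0 : 0 < complex.Re e by rewrite -ltcR -eE.
have hs : has_sup (range r).
  by split; [exists (r 0%N), 0%N | exists b => _ [n _ <-]].
have [_ [N _ <-] rN] := sup_adherent e'0 hs.
have le n m : (N <= n)%N -> (n <= m)%N -> `|u m - u n| < e.
  move=> Nn nm; apply: le_lt_trans (ur _ _ nm) _; rewrite eE ltcR.
  have rm : r m <= sup (range r) by apply: sup_upper_bound => //; exists m.
  have : 0 <= r n - r N.
    by rewrite -lecR; apply: le_trans (ur _ _ Nn).
  by lra.
exists N => n m Nn Nm; case/orP: (leq_total n m) => nm.
  by rewrite distrC; exact: le.
exact: le.
Qed.

(** The constant in [bounded_op] is any scalar, unconstrained when the space is zero; [|M| + 1] is a
    positive replacement. *)
Lemma bounded_op_pos X Y (A : X -> Y) :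
  bounded_op A -> exists2 M : C, 0 < M & forall x, `|A x| <= M * `|x|.
Proof.
move=> [M AM]; exists (`|M| + 1) => [|x]; first by rewrite ltr_wpDl.
have le := AM x; apply: le_trans le _.
have M0 : 0 <= M * `|x| by apply: le_trans (AM x).
by rewrite -(ger0_norm M0) normrM normr_id ler_wpM2r // lerDl.
Qed.

Lemma bounded_op_cvg X Y (A : {linear X -> Y}) (u : nat -> X) (l : X) :
  bounded_op A -> u @ \oo --> l -> (A \o u) @ \oo --> A l.
Proof.
move=> /bounded_op_pos[M M0 AM] ul; apply/cvgrPdist_lt => e e0.
have eM : 0 < e / M by rewrite divr_gt0.
move/cvgrPdist_lt : ul => /(_ _ eM); apply: filterS => n /= un.
rewrite -linearB /=; apply: le_lt_trans (AM _) _.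
by rewrite -ltr_pdivlMl // mulrC.
Qed.

Lemma lim_unique X (u : nat -> X) (l l' : X) :
  u @ \oo --> l -> u @ \oo --> l' -> l = l'.
Proof. by move=> ul ul'; apply: (cvg_unique _ ul ul'); exact: norm_hausdorff. Qed.

Lemma cvg_norm_le X (u : nat -> X) (l : X) (r : C) :
  u @ \oo --> l -> (forall n, `|u n| <= r) -> `|l| <= r.
Proof.
move=> ul ur; have rR : r \is Num.real.
  by apply: ger0_real; apply: le_trans (ur 0%N).
rewrite real_leNgt // ?ger0_real //; apply/negP => rl.
have e0 : 0 < `|l| - r by rewrite subr_gt0.
move/cvgrPdist_lt : ul => /(_ _ e0) [N _ /(_ N (leqnn N))] /=.
rewrite ltrBrDr => lt.
have : `|l| < `|l|.
  apply: le_lt_trans lt; rewrite -{1}(subrK (u N) l).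
  by apply: le_trans (ler_normD _ _) _; rewrite lerD2l.
by rewrite ltxx.
Qed.

End Sequences.

(** * Riesz representation *)

Section Riesz.
Variables (R : realType).
Local Notation C := R[i].

Variable X : hilbertType C.

(* A sequence minimizing [|x|^2 - 2 Re (f x)] is Cauchy by the parallelogram
   identity, and its limit represents [f]. *)
Theorem riesz_representation (f : X -> C) :
  (forall a x y, f (a *: x + y) = a * f x + f y) ->
  (exists M : C, forall x, `|f x| <= M * `|x|) ->
  exists y, forall x, f x = '[x, y].
Proof.
move=> fP [M fM].
(* For the representing vector [y] sought, [J x] is [|x - y|^2 - |y|^2], so [y] is the minimizer. *)
pose J x : C := '[x, x] - (f x + (f x)^*).
have f0 : f 0 = 0.
  by have := fP 1 0 0; rewrite scale1r addr0 mul1r => /eqP; rewrite addrC -subr_eq subrr => /eqP.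
have JD x h t : J (x + t *: h) =
  J x + t * t^* * '[h, h] - (t * (f h - '[h, x]) + t^* * (f h - '[h, x])^*).
  rewrite /J [x + _]addrC fP innerDl !innerDr !innerZl !innerZr (innerC x h).
  by rewrite !rmorphD rmorphN !rmorphM /=; ring.
have JR x : J x = (complex.Re (J x))%:C%C.
  apply: real_Re; rewrite rpredB ?(ger0_real (inner_ge0 _)) //.
  by apply/CrealP; rewrite rmorphD /= conjCK addrC.
have [M1 M0 {}fM] : exists2 M : C, 0 <= M & forall x, `|f x| <= M * `|x|.
  exists `|M| => // x; have := fM x => le.
  by rewrite -[`|x|]normr_id -normrM ger0_norm // (le_trans _ le).
have Jlb x : - M1 ^+ 2 <= J x.
  have -> : J x = (`|x| - M1) ^+ 2 + (2 * (M1 * `|x|) - (f x + (f x)^*)) - M1 ^+ 2.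
    by rewrite /J -norm_sqr; ring.
  rewrite lerDr addr_ge0 //.
    by rewrite real_exprn_even_ge0 // rpredB // ger0_real.
  have -> : f x + (f x)^* = 2 * 'Re (f x).
    by rewrite ReE mulrCA divff ?mulr1 ?pnatr_eq0.
  rewrite subr_ge0 ler_wpM2l // (le_trans _ (fM x)) //.
  exact: (leif_Re_Creal (f x)).
pose j x := complex.Re (J x).
have hi : has_inf (range j).
  split; first by exists (j 0), 0.
  exists (complex.Re (- M1 ^+ 2)) => _ [x _ <-].
  by have := Jlb x; rewrite lecE => /andP[].
pose m := inf (range j).
have mJ x : m%:C%C <= J x.
  by rewrite JR lecR; apply: ge_inf; [case: hi|exists x].
have : forall n : nat, exists x, J x <= m%:C%C + n.+1%:R^-1.
  move=> n; have [_ [x _ <-] xm] := @inf_adherent R _ n.+1%:R^-1 (ltac:(by rewrite invr_gt0)) hi.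
  exists x; rewrite JR -[n.+1%:R](rmorph_nat (real_complex R)) -fmorphV -rmorphD lecR.
  exact: ltW.
case/choice => u uJ.
have uB n k : `|u n - u k| ^+ 2 <= 2 * (n.+1%:R^-1 + k.+1%:R^-1).
  (* [J] at the midpoint of [u n] and [u k] is at least the infimum [m]. *)
  have := mJ (u k + 2^-1 *: (u n - u k)).
  have -> : J (u k + 2^-1 *: (u n - u k)) =
    2^-1 * (J (u n) + J (u k)) - 4^-1 * `|u n - u k| ^+ 2.
    have -> : J (u n) = J (u k + 1 *: (u n - u k)) by rewrite scale1r addrC subrK.
    rewrite !JD norm_sqr rmorph1 fmorphV rmorph_nat; by field.
  have := uJ n; have := uJ k; set a := J _; set b := J _; set c := _ ^+ 2.
  move=> ak bn cm.
  rewrite -subr_ge0 in ak; rewrite -subr_ge0 in bn; rewrite -subr_ge0 in cm.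
  rewrite -subr_ge0.
  have -> : 2 * (n.+1%:R^-1 + k.+1%:R^-1) - c =
    4 * (2^-1 * (b + a) - 4^-1 * c - m%:C%C) + 2 * (m%:C%C + k.+1%:R^-1 - a) +
    2 * (m%:C%C + n.+1%:R^-1 - b).
    by set p := n.+1%:R^-1; set q := k.+1%:R^-1; field.
  by rewrite !addr_ge0 // mulr_ge0.
have [y uy] : exists y : X, u @ \oo --> y.
  apply: cauchy_seq_cvg => e e0.
  have e20 : 0 < e ^+ 2 / 4 by rewrite divr_gt0 // exprn_gt0.
  have [N eN] := natSinv_lt e20; exists N => n k Nn Nk.
  rewrite -ltr_sqr ?nnegrE ?(ltW e0) //; apply: le_lt_trans (uB n k) _.
  have le i : (N <= i)%N -> i.+1%:R^-1 <= N.+1%:R^-1 :> C.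
    by move=> Ni; rewrite lef_pV2 ?posrE ?ltr0n // ler_nat.
  apply: (@le_lt_trans _ _ (4 * N.+1%:R^-1)).
    have -> : 4 * N.+1%:R^-1 = 2 * (N.+1%:R^-1 + N.+1%:R^-1) :> C by ring.
    by rewrite ler_wpM2l // lerD // le.
  by rewrite mulrC -ltr_pdivlMr.
exists y => h.
pose c n := f h - '[h, u n].
(* Moving [u n] along [h] cannot take [J] below [m]. The step used is the optimal [(c n)^* / |h|^2]
   with [|h|^2 + 1] as denominator, which covers [h = 0]. *)
have cB n : `|c n| ^+ 2 <= (`|h| ^+ 2 + 1) * n.+1%:R^-1.
  set H := `|h| ^+ 2; have H0 : 0 <= H by rewrite exprn_ge0.
  have H1 : 0 < H + 1 by rewrite ltr_wpDl.
  have := mJ (u n + ((c n)^* / (H + 1)) *: h).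
  rewrite JD -norm_sqr -/H -/(c n) normCK.
  have -> : ((c n)^* / (H + 1))^* = c n / (H + 1).
    rewrite rmorphM fmorphV /= conjCK; congr (_ / _).
    by apply: conj_Creal; rewrite ger0_real // ltW.
  have := uJ n; set a := J _; set d := c n => an.
  rewrite -subr_ge0 in an; rewrite -subr_ge0 => bn; rewrite -subr_ge0.
  have -> : (H + 1) * n.+1%:R^-1 - d * d^* = (H + 1) * (m%:C%C + n.+1%:R^-1 - a) +
    (H + 1) * (a + d^* / (H + 1) * (d / (H + 1)) * H -
      (d^* / (H + 1) * d + d / (H + 1) * d^*) - m%:C%C) + d * d^* / (H + 1).
    by set p := n.+1%:R^-1; field; rewrite gt_eqF.
  apply: addr_ge0; first by apply: addr_ge0; apply: mulr_ge0 => //; exact: ltW.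
  by apply: divr_ge0; [rewrite -normCK exprn_ge0|exact: ltW].
apply/eqP; rewrite -subr_eq0 -normr_eq0; apply/eqP/le_anti; rewrite normr_ge0 andbT.
rewrite real_leNgt ?ger0_real //; apply/negP => e0; set e := `|_| in e0.
have H1 : 0 < `|h| ^+ 2 + 1 by rewrite ltr_wpDl // exprn_ge0.
have h1 : 0 < `|h| + 1 by rewrite ltr_wpDl.
have e2 : 0 < e / 2 by rewrite divr_gt0.
have e3 : 0 < (e / 2) ^+ 2 / (`|h| ^+ 2 + 1) by rewrite divr_gt0 // exprn_gt0.
have [N1 eN] := natSinv_lt e3.
move/cvgrPdist_lt : uy => /(_ (e / 2 / (`|h| + 1))) [|N2 _ uy]; first by rewrite divr_gt0.
pose n := maxn N1 N2.
have cn : `|c n| < e / 2.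
  rewrite -ltr_sqr ?nnegrE ?(ltW e2) //; apply: le_lt_trans (cB n) _.
  rewrite mulrC -ltr_pdivlMr //; apply: le_lt_trans eN.
  by rewrite lef_pV2 ?posrE ?ltr0n // ler_nat ltnS leq_maxl.
have yn : `|'[h, y - u n]| < e / 2.
  apply: le_lt_trans (inner_le_norm _ _) _.
  have := uy n (leq_maxr _ _); rewrite /= ltr_pdivlMr // => yn.
  by apply: le_lt_trans yn; rewrite mulrC ler_wpM2l // lerDl.
have : e < e.
  rewrite {2}[e]splitr; apply: le_lt_trans (ltrD cn yn).
  rewrite /e; have -> : f h - '[h, y] = c n - '[h, y - u n] by rewrite innerBr /c; ring.
  exact: ler_normB.
by rewrite ltxx.
Qed.

End Riesz.

(** * Adjoints and unitaries *)

Section Adjoint.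
Variables (R : realType).
Local Notation C := R[i].
Implicit Types X Y : hilbertType C.

(** As a relation, adjointness is symmetric and can be checked on an explicit candidate; [adjE] then
    identifies the chosen [adj]. *)
Definition adjoint_pair X Y (A : X -> Y) (B : Y -> X) : Prop :=
  forall x y, '[A x, y] = '[x, B y].

Lemma adjoint_pairC X Y (A : X -> Y) (B : Y -> X) :
  adjoint_pair A B -> adjoint_pair B A.
Proof. by move=> AB x y; rewrite innerC -AB -innerC. Qed.

Lemma adjoint_pair_linear X Y (A : X -> Y) (B : Y -> X) :
  adjoint_pair A B -> linear B.
Proof.
move=> AB a u v; apply: inner_inj => x.
by rewrite -AB !innerDr !innerZr !AB.
Qed.

(** [|B y|^2] is [<A (B y), y>], at most [M |B y| |y|]; then divide by [|B y|]. *)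
Lemma adjoint_pair_bound X Y (A : X -> Y) (B : Y -> X) (M : C) :
  adjoint_pair A B -> 0 <= M -> (forall x, `|A x| <= M * `|x|) ->
  forall y, `|B y| <= M * `|y|.
Proof.
move=> AB M0 AM y; have [->|y0] := eqVneq (B y) 0.
  by rewrite normr0 mulr_ge0.
have n0 : 0 < `|B y| by rewrite normr_gt0.
rewrite -(ler_pM2l n0) -expr2 norm_sqr -AB -[leLHS]ger0_norm; last first.
  by rewrite AB inner_ge0.
apply: le_trans (inner_le_norm _ _) _.
by rewrite mulrA ler_wpM2r // mulrC.
Qed.

Lemma adjE X Y (A : X -> Y) (B : Y -> X) : adjoint_pair A B -> adj A = B.
Proof.
move=> AB; apply/funext => y; rewrite /adj; apply: xget_unique => [x|x xE].
  exact: AB.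
by apply: inner_inj => x'; rewrite -xE AB.
Qed.

Lemma adjP X Y (A : X -> Y) : linear A -> bounded_op A -> adjoint_pair A (adj A).
Proof.
move=> Al [M AM] x y; rewrite /adj; case: xgetP => [z _ ->//|/= noz].
have [||z zE] := @riesz_representation R X (fun x => '[A x, y]).
- by move=> a u v; rewrite Al innerDl innerZl.
- exists (M * `|y|) => u; apply: le_trans (inner_le_norm _ _) _.
  by rewrite mulrAC ler_wpM2r.
by have /= := noz z; case.
Qed.

Lemma unitary_adjoint X Y (U : {linear X -> Y}) :
  unitary U -> adjoint_pair U (adj U).
Proof. by case=> Ub _ _; apply: adjP => //; exact: linearP. Qed.

Lemma unitary_inner X Y (U : {linear X -> Y}) :
  unitary U -> forall x y, '[U x, U y] = '[x, y].
Proof.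
move=> UU x y; rewrite unitary_adjoint //; case: UU => _ UK _.
by rewrite -[in RHS](congr1 (@^~ y) UK).
Qed.

(** Since [y = U (V y)], preservation of inner products turns [<U x, y>] into [<x, V y>]: a right
    inverse of an isometry is its adjoint. *)
Lemma unitaryP X Y (U : {linear X -> Y}) (V : Y -> X) :
  (forall x y, '[U x, U y] = '[x, y]) -> cancel V U ->
  adj U = V /\ unitary U.
Proof.
move=> Ui VK; have UV : adjoint_pair U V by move=> x y; rewrite -{1}(VK y) Ui.
have UE := adjE UV; split => //; split; last 2 first.
- apply/funext => x /=; rewrite UE; apply: inner_inj => z.
  by rewrite -UV Ui.
- by apply/funext => y /=; rewrite UE VK.
exists 1 => x; rewrite mul1r -ler_sqr ?nnegrE // !norm_sqr.
by rewrite Ui.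
Qed.

End Adjoint.

Section InnerLimits.
Variables (R : realType) (X : hilbertType R[i]).
Implicit Types (u v : nat -> X) (x y l k : X).

Lemma cvg_inner_eq u v (l k x y : X) :
  u @ \oo --> l -> v @ \oo --> k -> (forall n, '[u n, y] = '[x, v n]) ->
  '[l, y] = '[x, k].
Proof.
move=> ul vk uv.
have lim0 (w : nat -> X) (m z : X) : w @ \oo --> m ->
    (fun n => '[w n, z]) @ \oo --> '[m, z].
  move=> wm; apply/cvgrPdist_lt => e e0.
  have d0 : 0 < e / (`|z| + 1) by rewrite divr_gt0 // ltr_wpDl.
  move/cvgrPdist_lt : wm => /(_ _ d0); apply: filterS => n.
  rewrite ltr_pdivlMr ?ltr_wpDl // -innerBl; apply: le_lt_trans.
  by apply: le_trans (inner_le_norm _ _) _; rewrite ler_wpM2l // lerDl.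
have lim1 := lim0 _ _ y ul.
have : (fun n => '[x, v n]) @ \oo --> '[x, k].
  apply/cvgrPdist_lt => e e0.
  have /cvgrPdist_lt/(_ e e0) := lim0 _ _ x vk; apply: filterS => n.
  by rewrite -innerBl -innerBr (innerC x) norm_conjC.
rewrite -(_ : (fun n => '[u n, y]) = (fun n => '[x, v n])); last exact/funext.
by move=> lim2; apply: (cvg_unique _ lim1 lim2); exact: norm_hausdorff.
Qed.

End InnerLimits.

(** * Existence and uniqueness of positive square roots of [1 - A] *)

Section SquareRoot.
Variables (R : realType).
Local Notation C := R[i].
Implicit Types X Y : hilbertType C.

(* The Visser iteration: its limit [L] satisfies [2 L = A + L^2], so that
   [(1 - L)^2 = 1 - A]. *)
Fixpoint sqrt_iter X (A : X -> X) (n : nat) (x : X) : X :=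
  if n is m.+1 then 2^-1 *: (A x + sqrt_iter A m (sqrt_iter A m x)) else 0.

(** The same recursion with the number [1] in place of [A]: a scalar majorant for the norms of the
    iterates and of their increments. *)
Fixpoint sqrt_rate (n : nat) : R :=
  if n is m.+1 then 2^-1 * (1 + sqrt_rate m ^+ 2) else 0.

Lemma sqrt_rate_bounds n : 0 <= sqrt_rate n <= 1.
Proof.
elim: n => [|n /andP[r0 r1]] /=; first by rewrite lexx ler01.
by apply/andP; split; nra.
Qed.

Lemma sqrt_rate_incr n : sqrt_rate n <= sqrt_rate n.+1.
Proof. by have /andP[r0 r1] := sqrt_rate_bounds n; rewrite /=; nra. Qed.

(** Each iterate is a polynomial in its operator. With [A = B] and [T] itself an iterate, this also
    yields commutation of the iterates. *)
Lemma sqrt_iter_intertwine X Y (A : X -> X) (B : Y -> Y) (T : X -> Y) :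
  linear T -> (forall x, T (A x) = B (T x)) ->
  forall n x, T (sqrt_iter A n x) = sqrt_iter B n (T x).
Proof.
move=> Tl TA; elim=> [|n IH] x /=.
  exact: linear_fun0.
by rewrite (linear_funZ Tl) (linear_funD Tl) TA !IH.
Qed.

Section Contraction.
Variables (X : hilbertType C) (A : X -> X).
Hypotheses (Al : linear A) (A1 : forall x, `|A x| <= `|x|)
  (As : adjoint_pair A A).

Local Notation L := (sqrt_iter A).
Local Notation r := sqrt_rate.

Lemma sqrt_iterS n x : L n.+1 x = 2^-1 *: (A x + L n (L n x)).
Proof. by []. Qed.

Lemma sqrt_rateS n : r n.+1 = 2^-1 * (1 + r n ^+ 2).
Proof. by []. Qed.

Lemma sqrt_iter_linear n : linear (L n).
Proof.
elim: n => [|n IH] a u v /=; first by rewrite scaler0 addr0.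
rewrite Al !IH scalerA mulrC -scalerA -scalerDr; congr (_ *: _).
by rewrite scalerDr addrACA.
Qed.

Lemma sqrt_iter_norm n x : `|L n x| <= (r n)%:C%C * `|x|.
Proof.
elim: n x => [|n IH] x /=; first by rewrite normr0 mul0r.
rewrite normrZ normfV normr_nat rmorphM rmorphD rmorphXn rmorph1 /=.
rewrite fmorphV rmorph_nat -mulrA ler_wpM2l ?invr_ge0 //.
apply: le_trans (ler_normD _ _) _; rewrite mulrDl mul1r lerD //.
apply: le_trans (IH _) _; rewrite expr2 -mulrA ler_wpM2l //.
by rewrite -[0]/(0%:C%C) lecR; case/andP: (sqrt_rate_bounds n).
Qed.

Lemma sqrt_iter_comm n m x : L n (L m x) = L m (L n x).
Proof.
apply: sqrt_iter_intertwine => [|y]; first exact: sqrt_iter_linear.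
by apply/esym/sqrt_iter_intertwine.
Qed.

Lemma sqrt_iter_sym n : adjoint_pair (L n) (L n).
Proof.
elim: n => [|n IH] x y /=; first by rewrite inner0l inner0r.
rewrite innerZl innerZr !innerDl !innerDr As !IH.
by rewrite fmorphV rmorph_nat.
Qed.

(** [L_{n+2} - L_{n+1}] is half of [L_{n+1}^2 - L_n^2], which factors because the iterates commute;
    the rates satisfy the same identity, so each factor is bounded by its scalar counterpart. *)
Lemma sqrt_iter_step n x :
  `|L n.+1 x - L n x| <= (r n.+1 - r n)%:C%C * `|x|.
Proof.
elim: n x => [|n IH] x.
  have -> : L 0 x = 0 by []; have -> : r 0%N = 0 by []; rewrite !subr0; exact: sqrt_iter_norm.
have -> : L n.+2 x - L n.+1 x =
    2^-1 *: (L n.+1 (L n.+1 x + L n x) - L n (L n.+1 x + L n x)).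
  rewrite (linear_funD (sqrt_iter_linear n.+1)) (linear_funD (sqrt_iter_linear n)).
  rewrite (sqrt_iter_comm n.+1 n).
  rewrite opprD addrA addrK.
  rewrite (sqrt_iterS n.+1) (sqrt_iterS n x).
  by rewrite -scalerBr opprD addrACA subrr add0r.
rewrite normrZ normfV normr_nat.
have -> : (r n.+2 - r n.+1)%:C%C =
    2^-1 * ((r n.+1 - r n)%:C%C * (r n.+1 + r n)%:C%C).
  have -> : r n.+2 - r n.+1 = 2^-1 * ((r n.+1 - r n) * (r n.+1 + r n)).
    by rewrite !(sqrt_rateS n.+1) (sqrt_rateS n); ring.
  by rewrite !rmorphM fmorphV rmorph_nat.
rewrite -mulrA ler_wpM2l ?invr_ge0 //; apply: le_trans (IH _) _.
rewrite -mulrA ler_wpM2l //.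
  by rewrite -[0]/(0%:C%C) lecR subr_ge0; exact: sqrt_rate_incr.
apply: le_trans (ler_normD _ _) _; rewrite rmorphD mulrDl.
by apply: lerD; exact: sqrt_iter_norm.
Qed.

Lemma sqrt_iter_cvg x : exists l : X, (fun n => L n x) @ \oo --> l.
Proof.
have xE := ger0_Re (normr_ge0 x).
apply: (@incr_dominated_cvg R X _ (fun n => r n * complex.Re `|x|) (complex.Re `|x|)).
  by move=> n; rewrite -mulrBl rmorphM /= -xE sqrt_iter_step.
move=> n; rewrite ler_piMl //; last by case/andP: (sqrt_rate_bounds n).
by rewrite -lecR -xE; exact: normr_ge0.
Qed.

Definition sqrt_lim (x : X) : X := sval (cid (sqrt_iter_cvg x)).

Lemma sqrt_limP x : (fun n => L n x) @ \oo --> sqrt_lim x.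
Proof. by rewrite /sqrt_lim; case: cid. Qed.

Lemma sqrt_lim_linear : linear sqrt_lim.
Proof.
move=> a u v; apply: (lim_unique (@sqrt_limP _)).
rewrite [X in X @ _](_ : _ = (fun n => a *: L n u + L n v)); last first.
  by apply/funext => n; rewrite sqrt_iter_linear.
by apply: cvgD; [apply: cvgZr; exact: sqrt_limP|exact: sqrt_limP].
Qed.

Lemma sqrt_lim_norm x : `|sqrt_lim x| <= `|x|.
Proof.
apply: cvg_norm_le (@sqrt_limP x) _ => n; apply: le_trans (sqrt_iter_norm _ _) _.
rewrite ler_piMl // -[1]/(1%:C%C) lecR.
by case/andP: (sqrt_rate_bounds n).
Qed.

Lemma sqrt_lim_sym : adjoint_pair sqrt_lim sqrt_lim.
Proof.
move=> x y; apply: cvg_inner_eq (@sqrt_limP x) (@sqrt_limP y) _ => n.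
exact: sqrt_iter_sym.
Qed.

Lemma sqrt_lim_fixed x : sqrt_lim x + sqrt_lim x = A x + sqrt_lim (sqrt_lim x).
Proof.
have l1 : (fun n => L n.+1 x + L n.+1 x) @ \oo --> sqrt_lim x + sqrt_lim x.
  by apply: cvgD; have := @sqrt_limP x; rewrite -cvg_shiftS.
apply: (lim_unique l1).
rewrite [X in X @ _](_ : _ = (fun n => A x + L n (L n x))); last first.
  by apply/funext => n; rewrite -scalerDl (_ : 2^-1 + 2^-1 = 1) ?scale1r //; field.
apply: cvgD; first exact: cvg_cst.
apply/cvgrPdist_lt => e e0; have e2 : 0 < e / 2 by rewrite divr_gt0.
have /cvgrPdist_lt/(_ _ e2) := @sqrt_limP (sqrt_lim x).
have /cvgrPdist_lt/(_ _ e2) := @sqrt_limP x.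
apply: filterS2 => n h1 h2.
(* Operator and argument vary together; the second term is small because every [L n] is a
   contraction. *)
have -> : sqrt_lim (sqrt_lim x) - L n (L n x) =
    (sqrt_lim (sqrt_lim x) - L n (sqrt_lim x)) + L n (sqrt_lim x - L n x).
  by rewrite (linear_funB (sqrt_iter_linear n)) addrA subrK.
rewrite [e]splitr; apply: le_lt_trans (ler_normD _ _) _; apply: ltr_leD => //.
apply: le_trans (sqrt_iter_norm _ _) _; apply: le_trans (ltW h1).
by rewrite ler_piMl // -[1]/(1%:C%C) lecR; case/andP: (sqrt_rate_bounds n).
Qed.

Definition sqrt_root x := x - sqrt_lim x.

Lemma sqrt_root_linear : linear sqrt_root.
Proof.
by move=> a u v; rewrite /sqrt_root sqrt_lim_linear scalerBr opprD addrACA.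
Qed.

Lemma sqrt_root_sym : adjoint_pair sqrt_root sqrt_root.
Proof.
by move=> x y; rewrite innerBl innerBr sqrt_lim_sym.
Qed.

Lemma sqrt_root_bounded : bounded_op sqrt_root.
Proof.
exists 2 => x; apply: le_trans (ler_normB _ _) _.
by rewrite mulrDl mul1r lerD2l sqrt_lim_norm.
Qed.

Lemma sqrt_root_ge0 x : 0 <= '[sqrt_root x, x].
Proof.
rewrite innerBl subr_ge0 -norm_sqr.
have lR : '[sqrt_lim x, x] \is Num.real.
  by apply/CrealP; rewrite -innerC sqrt_lim_sym.
apply: le_trans (real_ler_norm lR) _; apply: le_trans (inner_le_norm _ _) _.
by rewrite expr2 ler_wpM2r // sqrt_lim_norm.
Qed.

Lemma sqrt_rootK x : sqrt_root (sqrt_root x) = x - A x.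
Proof.
rewrite /sqrt_root (linear_funB sqrt_lim_linear); have := sqrt_lim_fixed x.
move: (sqrt_lim (sqrt_lim x)) (sqrt_lim x) => v u /eqP.
rewrite -subr_eq => /eqP <-.
by rewrite -addrA -opprD addrA.
Qed.

End Contraction.

(** Used twice: with [T] a row operator, to move it past the defects, and with [T] a competing root,
    to make it commute with the constructed one. *)
Lemma sqrt_lim_intertwine X Y (A : X -> X) (B : Y -> Y) (T : {linear X -> Y})
  (Al : linear A) (A1 : forall x, `|A x| <= `|x|)
  (Bl : linear B) (B1 : forall x, `|B x| <= `|x|) :
  bounded_op T -> (forall x, T (A x) = B (T x)) ->
  forall x, T (sqrt_root Al A1 x) = sqrt_root Bl B1 (T x).
Proof.
move=> Tb TA x; rewrite /sqrt_root linearB; congr (_ - _).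
apply: (lim_unique (bounded_op_cvg Tb (@sqrt_limP _ _ Al A1 x))).
rewrite [X in X @ _](_ : _ = (fun n => sqrt_iter B n (T x))); last first.
  by apply/funext => n /=; rewrite -(sqrt_iter_intertwine (linearP T) TA).
exact: sqrt_limP.
Qed.

(** Complex polarization: the form is real at [y + x] and at [i y + x], and the two resulting
    identities add up to ['[P y, x] = ('[P x, y])^*]. *)
Lemma positive_sym X (P : X -> X) : linear P -> (forall x, 0 <= '[P x, x]) ->
  adjoint_pair P P.
Proof.
move=> Pl P0 y x; rewrite (innerC y).
have PR z : ('[P z, z])^* = '[P z, z] by apply: conj_Creal; rewrite ger0_real.
have := PR ('i *: y + x); have := PR (1 *: y + x).
rewrite !Pl !innerDl !innerDr !innerZl !innerZr.
have := PR x; have := PR y.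
set a := '[P x, x]; set b := '[P y, y]; set p := '[P x, y]; set q := '[P y, x].
move=> bR aR; rewrite !(rmorphD, rmorphM) /= !conjCK aR bR rmorph1 conjCi => e1 e2.
have {}e1 : p^* + q^* = p + q.
  by apply/eqP; rewrite -subr_eq0; move/eqP : e1; rewrite -subr_eq0 => /eqP <-; apply/eqP; ring.
have {}e2 : p^* - q^* = q - p.
  apply: (mulfI (neq0Ci C)).
  by apply/eqP; rewrite -subr_eq0; move/eqP : e2; rewrite -subr_eq0 => /eqP <-; apply/eqP; ring.
have : 2 * q = 2 * p^*.
  have -> : 2 * q = (p + q) + (q - p) by ring.
  by rewrite -e1 -e2; ring.
by apply: mulfI; rewrite pnatr_eq0.
Qed.

(** Degenerate Cauchy-Schwarz for the form of [S]: if [S y] were nonzero, moving [y] against [S y]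
    would make the form negative. *)
Lemma positive_kernel X (S : X -> X) y : linear S -> adjoint_pair S S ->
  (forall x, 0 <= '[S x, x]) -> '[S y, y] = 0 -> S y = 0.
Proof.
move=> Sl Ss S0 Sy; apply: inner_eq0.
pose h := S y; pose p := '[h, h]; pose q := '[S h, h].
have p0 : 0 <= p by exact: inner_ge0.
have q1 : 0 < q + 1 by rewrite ltr_wpDl // S0.
have tR : (- (p / (q + 1)))^* = - (p / (q + 1)).
  by apply: conj_Creal; rewrite rpredN ger0_real // divr_ge0 // ltW.
(* The minimizer [p / q] of [t^2 q - 2 t p], with [q + 1] for [q] to cover [q = 0]. *)
have := S0 (- (p / (q + 1)) *: h + y).
rewrite Sl !innerDl !innerDr !innerZl !innerZr Sy tR -/q.
have -> : '[S h, y] = p by rewrite Ss.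
rewrite -/h -/p => le.
have {le} : 0 <= - (p ^+ 2 * ((q + 2) / (q + 1) ^+ 2)).
  by apply: le_trans le _; rewrite le_eqVlt; apply/orP; left; apply/eqP; field; rewrite gt_eqF.
rewrite oppr_ge0 pmulr_lle0; last first.
  by rewrite divr_gt0 ?exprn_gt0 // ltr_wpDl // S0.
by move=> le; apply/eqP; rewrite -sqrf_eq0; apply/eqP/le_anti; rewrite le exprn_ge0.
Qed.

(** Uniqueness: a root [B] commutes with [A = 1 - B^2], hence with the limit [S], so [B + S] kills
    [y = B x - S x]. Both forms being nonnegative, [<S y, y> = 0]; then [S y = B y = 0] and
    [|y|^2 = <x, B y - S y> = 0]. *)
Lemma sqrt_opE X (A : X -> X)
  (Al : linear A) (A1 : forall x, `|A x| <= `|x|) (As : adjoint_pair A A) :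
  sqrt_op (fun x => x - A x) = sqrt_root Al A1 :> (X -> X).
Proof.
set S := sqrt_root Al A1.
have Sl : linear S := sqrt_root_linear Al A1.
have S0 : forall z, 0 <= '[S z, z] by exact: sqrt_root_ge0.
have Ss : adjoint_pair S S by exact: sqrt_root_sym.
have SK z : S (S z) = z - A z := sqrt_rootK Al A1 z.
apply: xget_unique.
  split=> //; first exact: sqrt_root_bounded.
  exact/funext.
move=> B [Bl Bb B0 BK]; have {}BK x : B (B x) = x - A x := congr1 (@^~ x) BK.
pose BL := HB.pack_for {linear X -> X} B (GRing.isLinear.Build C X X *:%R B Bl).
have BA x : BL (A x) = A (BL x).
  have := linear_funB Bl x (A x); rewrite -(BK x) (BK (B x)).
  by move=> /addrI/oppr_inj.
have BS x : B (S x) = S (B x) by apply: (@sqrt_lim_intertwine _ _ _ _ BL).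
apply/funext => x; apply/eqP; rewrite -subr_eq0; apply/eqP.
set y := B x - S x.
have By : B y = - S y.
  by rewrite /y (linear_funB Bl) (linear_funB Sl) BK BS SK [RHS]opprB.
have Sy : '[S y, y] = 0.
  by apply/le_anti; rewrite S0 andbT -oppr_ge0 -innerNl -By B0.
have {}Sy : S y = 0 by apply: positive_kernel.
apply: inner_eq0; rewrite {1}/y innerBl (positive_sym Bl B0) By Ss Sy.
by rewrite oppr0 subrr.
Qed.
End SquareRoot.

(** * Inverting [1 - K] for a strict contraction [K] *)

Section NeumannInverse.
Variables (R : realType) (X : hilbertType R[i]) (K : X -> X) (q : R).
Hypotheses (Kl : linear K) (q0 : 0 <= q) (q1 : q < 1)
  (Kq : forall x, `|K x| <= q%:C%C * `|x|).

Let KB x y : K (x - y) = K x - K y.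
Proof. exact: linear_funB. Qed.

Lemma neumann_exists y : exists x, x - K x = y.
Proof.
have yE := ger0_Re (normr_ge0 y).
(* [b (1 - q^n)] are the partial sums of the geometric series of ratio [q] starting at [|y|]; their
   increments dominate those of the Neumann sums [u]. *)
pose b := complex.Re `|y| / (1 - q).
have b0 : 0 <= b.
  by rewrite divr_ge0 // ?subr_ge0 ?(ltW q1) // -lecR -yE; exact: normr_ge0.
pose u := fix u n := if n is m.+1 then y + K (u m) else 0.
have qn n : 0 <= q ^+ n by rewrite exprn_ge0.
have [|n|l ul] := @incr_dominated_cvg R X u (fun n => b * (1 - q ^+ n)) b.
- elim=> [|n IH].
    have -> : b * (1 - q ^+ 1) - b * (1 - q ^+ 0) = complex.Re `|y|.
      by rewrite /b expr1 expr0; field; rewrite subr_eq0 gt_eqF.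
    by rewrite -yE /= (linear_fun0 Kl) addr0 subr0.
  have -> : u n.+2 - u n.+1 = K (u n.+1 - u n).
    by rewrite KB /= opprD addrACA subrr add0r.
  apply: le_trans (Kq _) _.
  have -> : b * (1 - q ^+ n.+2) - b * (1 - q ^+ n.+1) =
    q * (b * (1 - q ^+ n.+1) - b * (1 - q ^+ n)) by rewrite !exprS; ring.
  by rewrite rmorphM ler_wpM2l // -[0]/(0%:C%C) lecR.
- by rewrite ler_piMr // lerBlDr lerDl.
exists l; apply/eqP; rewrite subr_eq; apply/eqP.
have ul1 : (fun n => u n.+1) @ \oo --> l by have := ul; rewrite -cvg_shiftS.
apply: (lim_unique ul1); apply: cvgD; first exact: cvg_cst.
apply/cvgrPdist_lt => e e0.
move/cvgrPdist_lt : ul => /(_ e e0); apply: filterS => n; apply: le_lt_trans.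
rewrite -KB; apply: le_trans (Kq _) _.
by rewrite ler_piMl // -[1]/(1%:C%C) lecR ltW.
Qed.

Lemma neumann_bound x : `|x| <= (1 - q)^-1%:C%C * `|x - K x|.
Proof.
have q1' : 0 < (1 - q)%:C%C by rewrite -[0]/(0%:C%C) ltcR subr_gt0.
rewrite fmorphV ler_pdivlMl // rmorphB mulrBl mul1r.
by apply: le_trans (lerB_dist _ _); rewrite lerD2l lerN2.
Qed.

Lemma neumann_inj x y : x - K x = y - K y -> x = y.
Proof.
move=> e; apply/eqP; rewrite -subr_eq0 -normr_eq0; apply/eqP/le_anti.
rewrite normr_ge0 andbT; apply: le_trans (neumann_bound _) _.
by rewrite KB opprD addrACA -opprD e subrr normr0 mulr0.
Qed.

Lemma inv_opK y : inv_op (fun x => x - K x) y - K (inv_op (fun x => x - K x) y) = y.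
Proof.
rewrite /inv_op; case: xgetP => [x _ //|/= nox].
by have [x xy] := neumann_exists y; have := nox x.
Qed.

Lemma inv_op_canr x : inv_op (fun x => x - K x) (x - K x) = x.
Proof. exact/neumann_inj/inv_opK. Qed.

Lemma inv_op_linear : linear (inv_op (fun x => x - K x)).
Proof.
move=> a u v; apply: neumann_inj; rewrite inv_opK Kl opprD addrACA.
by rewrite -scalerBr !inv_opK.
Qed.

Lemma inv_op_bounded : bounded_op (inv_op (fun x => x - K x)).
Proof.
exists (1 - q)^-1%:C%C => y; apply: le_trans (neumann_bound _) _.
by rewrite inv_opK.
Qed.

End NeumannInverse.

(** * Unitaries from equal Gram matrices *)

Section Gram.
Variables (R : realType).
Local Notation C := R[i].
Implicit Types X Y : hilbertType C.

Lemma orthogonal_closed X (E : set X) :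
  closed [set x | forall e, E e -> '[x, e] = 0].
Proof.
move=> p clp e Ee; apply/eqP; rewrite -normr_eq0; apply/eqP/le_anti.
rewrite normr_ge0 andbT real_leNgt ?ger0_real //; apply/negP => c0.
have d0 : 0 < `|'[p, e]| / (`|e| + 1) by rewrite divr_gt0 // ltr_wpDl.
have [m [/= mE]] := clp _ (nbhsx_ballx p _ d0).
rewrite -ball_normE /= ltr_pdivlMr ?ltr_wpDl // => lt.
have : `|'[p, e]| < `|'[p, e]|.
  apply: le_lt_trans lt; have -> : '[p, e] = '[p - m, e] by rewrite innerBl (mE e Ee) subr0.
  by apply: le_trans (inner_le_norm _ _) _; rewrite ler_wpM2l // lerDl.
by rewrite ltxx.
Qed.

(** Transparent, so that membership unfolds to the orthogonality relations. As a closed subspace it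
    is a Hilbert space to which Riesz applies. *)
Definition orthogonal_subspace X (E : set X) : closedSubspace X.
Proof.
apply: (@ClosedSubspace C X [set x | forall e, E e -> '[x, e] = 0]).
- by move=> e _; exact: inner0l.
- by move=> a u v uE vE e Ee; rewrite innerDl innerZl uE // vE // mulr0 addr0.
- exact: orthogonal_closed.
Defined.

Lemma hsum_innerE X Y (u v : hsum X Y) : '[u, v] = '[u.1, v.1] + '[u.2, v.2].
Proof. by []. Qed.

(** Density of the span, phrased through the orthogonal complement so that no span is ever
    formed. *)
Definition total_family (I : Type) X (g : I -> X) : Prop :=
  forall x, (forall i, '[x, g i] = 0) -> x = 0.

(* Applying the Riesz theorem on the graph
   [{(a, b) | <a, g i> = <b, h i> for all i}] to [(a, b) |-> <a, x>]
   gives a point of the graph above [x]. *)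
Lemma gram_graph (I : Type) X Y (g : I -> X) (h : I -> Y) :
  (forall i j, '[g i, g j] = '[h i, h j]) -> total_family g ->
  forall x, exists y, (forall i, '[x, g i] = '[y, h i]) /\
    forall a b, (forall i, '[a, g i] = '[b, h i]) -> '[a, x] = '[b, y].
Proof.
move=> gh gtot x.
(* The graph is the orthogonal complement of these vectors, hence closed. *)
pose e i : hsum X Y := (g i, - h i).
pose G := orthogonal_subspace (range e).
have GP (m : hsum X Y) :
    m \in csub_pred G <-> forall i, '[m.1, g i] = '[m.2, h i].
  split=> [/asboolP mG i|mG].
    apply/eqP; rewrite -subr_eq0; apply/eqP.
    by rewrite -innerNr; apply: (mG (e i)); exists i.
  apply/asboolP => _ [i _ <-]; rewrite hsum_innerE /= mG innerNr.
  exact: subrr.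
have [||m0 m0P] := @riesz_representation R (csub G) (fun m => '[(csub_val m).1, x]).
- move=> a m m'.
  by rewrite [csub_val _](linearP (val : csub G -> hsum X Y)) innerDl innerZl.
- exists `|x| => m; apply: le_trans (inner_le_norm _ _) _.
  rewrite mulrC ler_wpM2l // csub_norm -ler_sqr ?nnegrE // hsum_norm.
  by rewrite lerDl exprn_ge0.
have /GP m0G := csub_valP m0.
have {}m0P a b : (forall i, '[a, g i] = '[b, h i]) ->
    '[a, x] = '[a, (csub_val m0).1] + '[b, (csub_val m0).2].
  move=> ab; have abG : ((a, b) : hsum X Y) \in csub_pred G by apply/GP.
  exact: (m0P (CSub abG)).
move: (csub_val m0).1 (csub_val m0).2 m0G m0P => a0 b0 ab0 xP.
(* The Riesz vector is the projection of [(x, 0)] onto the graph; on the graph of a unitary [U] this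
   is half of [(x, U x)], whence the doubling here and in the witness. The Gram hypothesis puts each
   [(g i, h i)] on the graph. *)
have xE : x = a0 + a0.
  apply/eqP; rewrite -subr_eq0; apply/eqP/gtot => i.
  rewrite innerBl (innerC x) (xP _ (h i)) => [|j]; last exact: gh.
  by rewrite rmorphD /= -!innerC innerDl -ab0 subrr.
exists (b0 + b0); split=> [i|a b ab]; first by rewrite xE !innerDl ab0.
have e1 := xP a b ab; move: (e1); rewrite {1}xE innerDr => /addrI e2.
by rewrite e1 e2 innerDr.
Qed.

(** The weak relation says that [U^*] sends [h i] to [g i]. Exchanging the two families gives [V], a
    right inverse of [U] because [h] is total. *)
Theorem gram_unitary (I : Type) X Y (g : I -> X) (h : I -> Y) :
  (forall i j, '[g i, g j] = '[h i, h j]) -> total_family g -> total_family h ->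
  exists2 U : {linear X -> Y},
    unitary U & forall x i, '[U x, h i] = '[x, g i].
Proof.
move=> gh gtot htot.
have /choice[U UP] := gram_graph gh gtot.
have /choice[V VP] := gram_graph (fun i j => esym (gh i j)) htot.
have hinj y y' : (forall i, '[y, h i] = '[y', h i]) -> y = y'.
  move=> e; apply/eqP; rewrite -subr_eq0; apply/eqP/htot => i.
  by rewrite innerBl e subrr.
have Ug x i : '[U x, h i] = '[x, g i] by rewrite (UP x).1.
have Ul : linear U.
  by move=> a u v; apply: hinj => i; rewrite innerDl innerZl !Ug innerDl innerZl.
pose UL := HB.pack_for {linear X -> Y} U (GRing.isLinear.Build C X Y *:%R U Ul).
exists UL; last exact: Ug.
have [] // := @unitaryP R X Y UL V.
  by move=> x y; apply/esym/(UP y).2 => i; rewrite Ug.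
by move=> y; apply: hinj => i; rewrite Ug (VP y).1.
Qed.

End Gram.

(** * Row operators, defects and resolvents *)

Section RowOperators.
Variables (R : realType).
Local Notation C := R[i].
Variables (d : nat) (X : hilbertType C).

Lemma ffun_innerE (u v : {ffun 'I_d -> X}) : '[u, v] = \sum_i '[u i, v i].
Proof. by []. Qed.

Lemma row_op_linear (T : 'I_d -> {linear X -> X}) : linear (row_op T).
Proof.
move=> a u v; rewrite /row_op scaler_sumr -big_split /=; apply: eq_bigr => i _.
by rewrite !ffunE linearP.
Qed.

HB.instance Definition _ (T : 'I_d -> {linear X -> X}) :=
  GRing.isLinear.Build C {ffun 'I_d -> X} X *:%R (row_op T) (row_op_linear T).

Definition Zadj (z : 'I_d -> C) (x : X) : {ffun 'I_d -> X} :=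
  [ffun i => (z i)^* *: x].

Lemma Zrow_adjoint z : adjoint_pair (Zrow z : {ffun 'I_d -> X} -> X) (Zadj z).
Proof.
move=> u x; rewrite /Zrow ffun_innerE linear_sumlz /=; apply: eq_bigr => i _.
by rewrite ffunE innerZl innerZr conjCK.
Qed.

Lemma adj_Zrow z : adj (Zrow z) = Zadj z.
Proof. exact/adjE/Zrow_adjoint. Qed.

Lemma Zadj_linear z : linear (Zadj z).
Proof. exact: adjoint_pair_linear (Zrow_adjoint z). Qed.

HB.instance Definition _ z :=
  GRing.isLinear.Build C X {ffun 'I_d -> X} *:%R (Zadj z) (Zadj_linear z).

Lemma Zrow_linear z : linear (Zrow z : {ffun 'I_d -> X} -> X).
Proof. exact: adjoint_pair_linear (adjoint_pairC (Zrow_adjoint z)). Qed.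

HB.instance Definition _ z :=
  GRing.isLinear.Build C {ffun 'I_d -> X} X *:%R (Zrow z) (Zrow_linear z).

(** The constant is the Euclidean norm of [z]: a direct computation for the column, carried to the
    row by taking adjoints. *)
Lemma unit_ball_bound z : unit_ball z -> exists q : R,
  [/\ 0 <= q, q < 1, forall x, `|Zadj z x| <= q%:C%C * `|x| &
      forall u : {ffun 'I_d -> X}, `|Zrow z u| <= q%:C%C * `|u|].
Proof.
rewrite /unit_ball /=; set s := \sum_i _ => s1.
have s0 : 0 <= s by apply: sumr_ge0 => i _; exact: exprn_ge0.
have q0 : 0 <= sqrtC s by rewrite sqrtC_ge0.
have qE := ger0_Re q0.
have ZadjB x : `|Zadj z x| <= sqrtC s * `|x|.
  rewrite -ler_sqr ?nnegrE // ?mulr_ge0 // exprMn ffun_norm [sqrtC s ^+ 2]sqrtCK mulr_suml.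
  by apply: ler_sum => i _; rewrite ffunE normrZ norm_conjC exprMn.
exists (complex.Re (sqrtC s)); rewrite -qE; split=> //.
- by rewrite -lecR -qE.
- by rewrite -ltcR -qE rmorph1 -[X in _ < X]sqrtC1 ltr_sqrtC ?nnegrE.
- exact: adjoint_pair_bound (adjoint_pairC (Zrow_adjoint z)) q0 ZadjB.
Qed.

Lemma unit_ball0 : unit_ball (fun _ : 'I_d => 0 : C).
Proof. by rewrite /unit_ball /= big1 // => i _; rewrite normr0 expr0n. Qed.

Lemma Zrow0 (u : {ffun 'I_d -> X}) : Zrow (fun=> 0) u = 0.
Proof. by rewrite /Zrow big1 // => i _; rewrite scale0r. Qed.

Lemma Zadj0 (x : X) : Zadj (fun=> 0) x = 0.
Proof. by apply/ffunP => i; rewrite !ffunE conjC0 scale0r. Qed.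

Lemma slot_linear (i : 'I_d) : linear (@slot C d X i).
Proof.
move=> a u v; apply/ffunP => j; rewrite !ffunE; case: eqP => // _.
by rewrite scaler0 addr0.
Qed.

HB.instance Definition _ i :=
  GRing.isLinear.Build C X {ffun 'I_d -> X} *:%R (@slot C d X i) (slot_linear i).

Lemma slot_norm i x : `|@slot C d X i x| = `|x|.
Proof.
rewrite !norm_innerE ffun_innerE (bigD1 i) //= ffunE eqxx.
by rewrite big1 ?addr0 // => j /negPf ji; rewrite ffunE ji inner0l.
Qed.

Lemma sum_slot (u : {ffun 'I_d -> X}) : u = \sum_i slot i (u i).
Proof.
apply/ffunP => j; rewrite sum_ffunE (bigD1 j) //= ffunE eqxx.
by rewrite big1 ?addr0 // => i /negPf ij; rewrite ffunE eq_sym ij.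
Qed.

Variable T : 'I_d -> {linear X -> X}.
Hypothesis T1 : forall u, `|row_op T u| <= `|u|.

Lemma row_adjP : adjoint_pair (row_op T) (row_adj T).
Proof.
by apply: adjP; [exact: linearP|exists 1 => u; rewrite mul1r].
Qed.

Lemma row_adj_norm x : `|row_adj T x| <= `|x|.
Proof.
rewrite -[leRHS]mul1r; apply: (adjoint_pair_bound row_adjP) => // u.
by rewrite mul1r.
Qed.

(** [T^* T] and [T T^*] are self-adjoint contractions, so [sqrt_opE] identifies both defects. *)
Let gram u := row_adj T (row_op T u).
Let cogram x := row_op T (row_adj T x).

Let row_adj_linear : linear (row_adj T).
Proof. exact: adjoint_pair_linear row_adjP. Qed.

Let gram_linear : linear gram.
Proof. by move=> a u v; rewrite /gram linearP row_adj_linear. Qed.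

Let gram_norm u : `|gram u| <= `|u|.
Proof. exact: le_trans (row_adj_norm _) (T1 _). Qed.

Let gram_sym : adjoint_pair gram gram.
Proof. by move=> u v; rewrite -row_adjP (adjoint_pairC row_adjP). Qed.

Let cogram_linear : linear cogram.
Proof. by move=> a u v; rewrite /cogram row_adj_linear linearP. Qed.

Let cogram_norm u : `|cogram u| <= `|u|.
Proof. exact: le_trans (T1 _) (row_adj_norm _). Qed.

Let cogram_sym : adjoint_pair cogram cogram.
Proof. by move=> u v; rewrite row_adjP (adjoint_pairC row_adjP). Qed.

Let defectE : defect T = sqrt_root gram_linear gram_norm :> (_ -> _).
Proof. exact: sqrt_opE gram_sym. Qed.

Let codefectE : codefect T = sqrt_root cogram_linear cogram_norm :> (_ -> _).
Proof. exact: sqrt_opE cogram_sym. Qed.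

Lemma defectK u : defect T (defect T u) = u - row_adj T (row_op T u).
Proof. by rewrite defectE sqrt_rootK. Qed.

Lemma defect_sym : adjoint_pair (defect T) (defect T).
Proof. by rewrite defectE; apply: sqrt_root_sym gram_sym. Qed.

Lemma defect_bounded : bounded_op (defect T).
Proof. by rewrite defectE; apply: sqrt_root_bounded. Qed.

Lemma codefect_bounded : bounded_op (codefect T).
Proof. by rewrite codefectE; apply: sqrt_root_bounded. Qed.

(** [T] intertwines [T^* T] with [T T^*], hence also their roots. *)
Lemma row_op_defect u : row_op T (defect T u) = codefect T (row_op T u).
Proof.
rewrite defectE codefectE.
have Tb : bounded_op (row_op T) by exists 1 => v; rewrite mul1r.
exact: (sqrt_lim_intertwine gram_linear gram_norm cogram_linear cogram_norm Tb).
Qed.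

Section Resolvents.
Variable z : 'I_d -> C.
Hypothesis zB : unit_ball z.

Let K x := Zrow z (row_adj T x).
Let K' u := Zadj z (row_op T u).

Let KB : exists q : R, [/\ 0 <= q, q < 1, linear K & forall x, `|K x| <= q%:C%C * `|x|].
Proof.
have [q [q0 q1 _ Zq]] := unit_ball_bound zB; exists q; split=> //.
  by move=> a u v; rewrite /K row_adj_linear linearP.
move=> x; apply: le_trans (Zq _) _; rewrite ler_wpM2l ?row_adj_norm //.
by rewrite -[0]/(0%:C%C) lecR.
Qed.

Let KB' : exists q : R, [/\ 0 <= q, q < 1, linear K' & forall x, `|K' x| <= q%:C%C * `|x|].
Proof.
have [q [q0 q1 Zq _]] := unit_ball_bound zB; exists q; split=> //.
  by move=> a u v; rewrite /K' !linearP.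
move=> x; apply: le_trans (Zq _) _; rewrite ler_wpM2l //.
by rewrite -[0]/(0%:C%C) lecR.
Qed.

Lemma resolvent_linear : linear (resolvent T z).
Proof. by have [q [q0 q1 Kl Kq]] := KB; exact: inv_op_linear Kl q0 q1 Kq. Qed.

Lemma resolvent_bounded : bounded_op (resolvent T z).
Proof. by have [q [q0 q1 Kl Kq]] := KB; exact: inv_op_bounded Kl q0 q1 Kq. Qed.

Lemma resolventK x : resolvent T z (x - Zrow z (row_adj T x)) = x.
Proof. by have [q [q0 q1 Kl Kq]] := KB; exact: inv_op_canr Kl q0 q1 Kq x. Qed.

Let coresolventE : coresolvent T z = inv_op (fun u => u - K' u).
Proof. by rewrite /coresolvent adj_Zrow. Qed.

Lemma coresolvent_linear : linear (coresolvent T z).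
Proof.
by rewrite coresolventE; have [q [q0 q1 Kl Kq]] := KB'; exact: inv_op_linear Kl q0 q1 Kq.
Qed.

Lemma coresolvent_bounded : bounded_op (coresolvent T z).
Proof.
by rewrite coresolventE; have [q [q0 q1 Kl Kq]] := KB'; exact: inv_op_bounded Kl q0 q1 Kq.
Qed.

Lemma coresolventK u : coresolvent T z (u - Zadj z (row_op T u)) = u.
Proof.
by rewrite coresolventE; have [q [q0 q1 Kl Kq]] := KB'; exact: inv_op_canr Kl q0 q1 Kq u.
Qed.

End Resolvents.

Lemma resolvent0 x : resolvent T (fun=> 0) x = x.
Proof. by rewrite -[in LHS](subr0 x) -(Zrow0 (row_adj T x)) (resolventK unit_ball0). Qed.

Lemma coresolvent0 u : coresolvent T (fun=> 0) u = u.
Proof. by rewrite -[in LHS](subr0 u) -(Zadj0 (row_op T u)) (coresolventK unit_ball0). Qed.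

End RowOperators.

(** * The factor [G_T] of the Agler kernel and the characteristic function at the origin *)

Section AglerMap.
Variables (R : realType).
Local Notation C := R[i].
Implicit Types X Y : hilbertType C.

Lemma to_closed_range_linear X Y (A : {linear X -> Y}) :
  linear (to_closed_range A).
Proof.
move=> a u v; apply: val_inj.
by rewrite (linearP (val : csub (closed_range A) -> Y)) /= linearP.
Qed.

Lemma bounded_op_comp X Y (Z : hilbertType C) (A : X -> Y) (B : Y -> Z) :
  bounded_op A -> bounded_op B -> bounded_op (B \o A).
Proof.
move=> [M AM] /bounded_op_pos[N N0 BN]; exists (N * M) => x.
by apply: le_trans (BN _) _; rewrite -mulrA ler_wpM2l // ltW.
Qed.

Lemma hsum_norm_le X Y (u : hsum X Y) : `|u| <= `|u.1| + `|u.2|.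
Proof.
rewrite -ler_sqr ?nnegrE ?addr_ge0 // hsum_norm sqrrD addrAC lerDl.
by rewrite mulrn_wge0 // mulr_ge0.
Qed.

Lemma ffun_norm_le (I : finType) X (u : {ffun I -> X}) : `|u| <= \sum_i `|u i|.
Proof.
rewrite -ler_sqr ?nnegrE ?sumr_ge0 // ffun_norm [leRHS]expr2 mulr_suml.
apply: ler_sum => i _; rewrite expr2 ler_wpM2l // (bigD1 i) //= lerDl.
exact: sumr_ge0.
Qed.

Lemma hsum_map_adjoint d X Y (X' Y' : hilbertType C) (a : X -> X') (b : Y -> Y')
    (a' : X' -> X) (b' : Y' -> Y) :
  adjoint_pair a a' -> adjoint_pair b b' ->
  adjoint_pair (@hsum_map C d _ _ _ _ a b) (hsum_map a' b').
Proof.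
move=> aa bb u v; rewrite !hsum_innerE aa; congr (_ + _).
by rewrite !ffun_innerE; apply: eq_bigr => i _; rewrite !ffunE bb.
Qed.

Lemma hsum_map_can d X Y (X' Y' : hilbertType C) (a : X -> X') (b : Y -> Y')
    (a' : X' -> X) (b' : Y' -> Y) :
  cancel a a' -> cancel b b' ->
  cancel (@hsum_map C d _ _ _ _ a b) (hsum_map a' b').
Proof.
move=> aK bK [u v]; rewrite /hsum_map /= aK; congr pair.
by apply/ffunP => i; rewrite !ffunE bK.
Qed.

Variables (d : nat) (X : hilbertType C) (T : 'I_d -> {linear X -> X}).

Definition codefect_resolvent (z : 'I_d -> C) (x : X) : codefect_space T :=
  to_closed_range (codefect T) (resolvent T z x).

(** The lower blocks of [agler_G] are the values of this map on slots. It is kept on the whole power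
    because the kernel condition and the coresolvent identity concern general columns. *)
Definition defect_coresolvent (z : 'I_d -> C) (u : {ffun 'I_d -> X}) :
    defect_space T :=
  to_closed_range (defect T) (coresolvent T z u).

Hypothesis T1 : forall u, `|row_op T u| <= `|u|.

Lemma codefect_resolvent_linear z :
  unit_ball z -> linear (codefect_resolvent z).
Proof.
move=> zB a x y.
by rewrite /codefect_resolvent (resolvent_linear T1 zB) to_closed_range_linear.
Qed.

Lemma defect_coresolvent_linear z :
  unit_ball z -> linear (defect_coresolvent z).
Proof.
move=> zB a x y.
by rewrite /defect_coresolvent (coresolvent_linear T1 zB) to_closed_range_linear.
Qed.

Lemma agler_G_linear z : unit_ball z -> linear (agler_G T z).
Proof.
move=> zB a x y; congr pair; first exact: (codefect_resolvent_linear zB).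
apply/ffunP => i; rewrite !ffunE linearP.
exact: (defect_coresolvent_linear zB).
Qed.

Lemma agler_G_bounded z : unit_ball z -> bounded_op (agler_G T z).
Proof.
move=> zB.
have [M MP] := bounded_op_comp (resolvent_bounded T1 zB) (codefect_bounded T1).
have [N NP] := bounded_op_comp (coresolvent_bounded T1 zB) (defect_bounded T1).
exists (M + \sum_(i < d) N) => x; rewrite mulrDl mulr_suml.
apply: le_trans (hsum_norm_le _) _; apply: lerD.
  by rewrite csub_norm; exact: MP.
apply: le_trans (ffun_norm_le _) _; apply: ler_sum => i _.
by rewrite ffunE csub_norm -(slot_norm i x); exact: NP.
Qed.

Lemma agler_G_adjoint z :
  unit_ball z -> adjoint_pair (agler_G T z) (adj (agler_G T z)).
Proof.
by move=> zB; apply: adjP; [exact: agler_G_linear|exact: agler_G_bounded].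
Qed.

(** Makes the vectors [G_T(z)^* u] total. The second kernel condition follows from the lower blocks
    because [Z(z)^* x] is a sum of slots filled with multiples of [x]. *)
Lemma agler_G_total x : strongly_closely_connected T ->
  (forall z, unit_ball z -> agler_G T z x = 0) -> x = 0.
Proof.
move=> scc G0; suff : scc_kernel T x by rewrite scc.
split=> z zB; first by have /(congr1 (fun v => csub_val v.1)) := G0 z zB.
have Q0 i y : agler_G T z y = 0 -> defect_coresolvent z (slot i y) = 0.
  by move=> /(congr1 (fun v : hsum _ {ffun _ -> _} => v.2 i)); rewrite !ffunE.
suff : defect_coresolvent z (adj (Zrow z) x) = 0 by move=> /(congr1 (@csub_val _ _ _)).
rewrite adj_Zrow [Zadj z x]sum_slot (linear_fun_sum (defect_coresolvent_linear zB)).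
apply: big1 => i _; apply: Q0.
have := agler_G_linear zB ((z i)^*) x 0; rewrite G0 // scaler0 add0r !addr0 ffunE => ->.
by rewrite (linear_fun0 (agler_G_linear zB)).
Qed.

(** [T D_T u = D_{T^*} T u] lies in the range of [D_{T^*}], so [insubd] does not fall back on its
    default. *)
Lemma char_fun0_defect u :
  char_fun T (fun=> 0) (to_closed_range (defect T) u) =
  to_closed_range (codefect T) (- row_op T u).
Proof.
rewrite /char_fun Zrow0 (resolvent0 T1) linear0 addr0 /= row_op_defect //.
by rewrite -linearN; apply: val_inj; apply: insubdK; exact: range_csub.
Qed.

End AglerMap.

(** * From intertwined kernels to intertwined row operators *)

Section Intertwining.
Variables (R : realType) (d : nat).
Local Notation C := R[i].
Variables (X Xt : hilbertType C).
Variables (T : 'I_d -> {linear X -> X}) (S : 'I_d -> {linear Xt -> Xt}).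
Variables (alpha : {linear codefect_space S -> codefect_space T})
  (beta : {linear defect_space S -> defect_space T}) (U : {linear Xt -> X}).
Hypotheses (T1 : forall u, `|row_op T u| <= `|u|)
  (S1 : forall u, `|row_op S u| <= `|u|).
Hypotheses (betaU : unitary beta) (UU : unitary U).
Hypothesis UG : forall z x, unit_ball z ->
  agler_G T z (U x) = hsum_map alpha beta (agler_G S z x).
Hypothesis char0 : forall v,
  char_fun T (fun=> 0) (beta v) = alpha (char_fun S (fun=> 0) v).

Let Ud (u : {ffun 'I_d -> Xt}) : {ffun 'I_d -> X} := [ffun i => U (u i)].

Let codefect_resolvent_U z x : unit_ball z ->
  codefect_resolvent T z (U x) = alpha (codefect_resolvent S z x).
Proof. by move=> zB; have /(congr1 fst) := UG x zB. Qed.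

(** [UG] gives this on slots only; every column is a sum of slots. *)
Let defect_coresolvent_U z u : unit_ball z ->
  defect_coresolvent T z (Ud u) = beta (defect_coresolvent S z u).
Proof.
move=> zB; rewrite [Ud u]sum_slot [u in RHS]sum_slot.
rewrite (linear_fun_sum (defect_coresolvent_linear T1 zB)).
rewrite (linear_fun_sum (defect_coresolvent_linear S1 zB)) linear_sum.
apply: eq_bigr => i _; rewrite ffunE.
have /(congr1 (fun v : hsum _ {ffun _ -> _} => v.2 i)) := UG (u i) zB.
by rewrite !ffunE.
Qed.

Let codefect_U x : to_closed_range (codefect T) (U x) =
  alpha (to_closed_range (codefect S) x).
Proof.
have := codefect_resolvent_U x (unit_ball0 R d).
by rewrite /codefect_resolvent !resolvent0.
Qed.

Let defect_U u : to_closed_range (defect T) (Ud u) =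
  beta (to_closed_range (defect S) u).
Proof.
have := defect_coresolvent_U u (unit_ball0 R d).
by rewrite /defect_coresolvent !coresolvent0.
Qed.

(** Evaluating [char0] at [D_S u] gives [- D_{T^*} T U^d u] on one side and [- alpha D_{S^*} S u] on
    the other; [codefect_U] rewrites the latter. *)
Let codefect_row_op_U u :
  to_closed_range (codefect T) (row_op T (Ud u)) =
  to_closed_range (codefect T) (U (row_op S u)).
Proof.
have := char0 (to_closed_range (defect S) u).
rewrite -defect_U !char_fun0_defect // -codefect_U linearN.
rewrite !(linear_funN (to_closed_range_linear _)).
by move=> /oppr_inj.
Qed.

Let Ud_inner u v : '[Ud u, Ud v] = '[u, v].
Proof.
rewrite !ffun_innerE; apply: eq_bigr => i _.
by rewrite !ffunE unitary_inner.
Qed.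

(* [T^* T = 1 - D_T^2], and [D_T U = beta D_S] with [beta] isometric. *)
Let gram_U u :
  row_adj T (row_op T (Ud u)) = Ud (row_adj S (row_op S u)).
Proof.
apply: inner_inj => v.
(* [U] is onto, so it is enough to test against the range of [Ud]. *)
have -> : v = Ud [ffun i => adj U (v i)].
  by apply/ffunP => i; rewrite !ffunE; case: UU => _ _ /(congr1 (@^~ (v i))) /= ->.
set w := finfun _; rewrite Ud_inner.
have DT : row_adj T (row_op T (Ud u)) = Ud u - defect T (defect T (Ud u)).
  by rewrite defectK // opprB addrC subrK.
have DS : row_adj S (row_op S u) = u - defect S (defect S u).
  by rewrite defectK // opprB addrC subrK.
rewrite DT DS !innerBr Ud_inner; congr (_ - _).
rewrite -(defect_sym T1) -(defect_sym S1).
have := unitary_inner betaU (to_closed_range (defect S) w) (to_closed_range (defect S) u).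
by rewrite -!defect_U.
Qed.

Let Zrow_U z u : Zrow z (Ud u) = U (Zrow z u).
Proof.
by rewrite /Zrow linear_sum; apply: eq_bigr => i _; rewrite ffunE linearZ.
Qed.

Let Zadj_U z x : Zadj z (U x) = Ud (Zadj z x).
Proof. by apply/ffunP => i; rewrite !ffunE linearZ. Qed.

(** The identity [R = 1 + R Z P^*] for the resolvent [R], for any row contraction so that it serves
    [T] and [S] alike. *)
Let codefect_resolvent_expand (Y : hilbertType C) (P : 'I_d -> {linear Y -> Y}) z y :
  (forall u, `|row_op P u| <= `|u|) -> unit_ball z ->
  codefect_resolvent P z y = to_closed_range (codefect P) y +
    codefect_resolvent P z (Zrow z (row_adj P y)).
Proof.
move=> P1 zB; rewrite /codefect_resolvent.
rewrite -(linear_funD (to_closed_range_linear (codefect P))).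
rewrite -{2}(resolventK P1 zB y) (linear_funB (resolvent_linear P1 zB)).
by rewrite subrK.
Qed.

(** The identity [Q Z^* P = Q - 1] for the coresolvent [Q]. *)
Let defect_coresolvent_expand (Y : hilbertType C) (P : 'I_d -> {linear Y -> Y}) z u :
  (forall u, `|row_op P u| <= `|u|) -> unit_ball z ->
  defect_coresolvent P z (Zadj z (row_op P u)) =
    defect_coresolvent P z u - to_closed_range (defect P) u.
Proof.
move=> P1 zB; rewrite /defect_coresolvent.
rewrite -(linear_funB (to_closed_range_linear (defect P))).
rewrite -{3}(coresolventK P1 zB u) (linear_funB (coresolvent_linear P1 zB)).
by rewrite opprB addrC subrK.
Qed.

Lemma row_op_intertwine u :
  strongly_closely_connected T -> row_op T (Ud u) = U (row_op S u).
Proof.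
move=> scc; apply: subr0_eq.
suff : scc_kernel T (row_op T (Ud u) - U (row_op S u)) by rewrite scc.
split=> z zB.
  apply: (congr1 (@csub_val _ _ _) (_ : codefect_resolvent T z _ = 0)).
  rewrite (linear_funB (codefect_resolvent_linear T1 zB)).
  apply/eqP; rewrite subr_eq0; apply/eqP.
  (* At [T U^d u] the expansion exposes [D_{T^*} T U^d u] and [T^* T U^d u], both already
     transported by [U]; the same expansion for [S] folds the result back. *)
  rewrite codefect_resolvent_expand // codefect_row_op_U gram_U Zrow_U.
  rewrite !codefect_resolvent_U // codefect_U -linearD.
  by rewrite -codefect_resolvent_expand.
rewrite adj_Zrow.
apply: (congr1 (@csub_val _ _ _) (_ : defect_coresolvent T z _ = 0)).
rewrite linearB /= (linear_funB (defect_coresolvent_linear T1 zB)).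
(* Here the expansion removes the bare [T], and the two relations with [beta] are enough. *)
rewrite defect_coresolvent_expand // Zadj_U !defect_coresolvent_U // defect_U.
by rewrite -linearB -defect_coresolvent_expand // subrr.
Qed.

Lemma component_intertwine i :
  strongly_closely_connected T -> T i = U \o S i \o adj U :> (X -> X).
Proof.
move=> scc; apply/funext => x.
have row_slot (Y : hilbertType C) (P : 'I_d -> {linear Y -> Y}) y :
    row_op P (slot i y) = P i y.
  rewrite /row_op (bigD1 i) //= ffunE eqxx big1 ?addr0 // => j /negPf ji.
  by rewrite ffunE ji linear0.
have := row_op_intertwine (slot i (adj U x)) scc.
have -> : Ud (slot i (adj U x)) = slot i x.
  apply/ffunP => j; rewrite !ffunE; case: eqP => // _; last exact: linear0.
  by case: UU => _ _ /(congr1 (@^~ x)).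
by rewrite !row_slot.
Qed.

End Intertwining.

Theorem theorem5p9 (R : realType) (d : nat) (X Xt : hilbertType R[i])
    (T : 'I_d -> {linear X -> X}) (S : 'I_d -> {linear Xt -> Xt})
    (hT : commutative_row_contraction T) (hS : commutative_row_contraction S)
    (sccT : strongly_closely_connected T) (sccS : strongly_closely_connected S)
    (coincide :
      exists (alpha : {linear codefect_space S -> codefect_space T})
             (beta : {linear defect_space S -> defect_space T}),
        [/\ unitary alpha, unitary beta &
          forall z w : 'I_d -> R[i], unit_ball z -> unit_ball w ->
            char_fun T z = alpha \o char_fun S z \o adj beta /\
            agler_K T z w =
              hsum_map alpha beta \o agler_K S z w
                \o hsum_map (adj alpha) (adj beta)]) :
  exists U : {linear Xt -> X},
    unitary U /\ forall i : 'I_d, T i = U \o S i \o adj U :> (X -> X).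
Proof.
have [_ _ T1] := hT; have [_ _ S1] := hS.
have [alpha [beta [ualpha ubeta TS]]] := coincide.
pose Gam := @hsum_map _ d _ _ _ _ alpha beta.
pose Gam' := @hsum_map _ d _ _ _ _ (adj alpha) (adj beta).
have GamA : adjoint_pair Gam Gam'.
  by apply: hsum_map_adjoint; exact: unitary_adjoint.
have GamK : cancel Gam Gam'.
  by apply: hsum_map_can => u; [case: ualpha => _|case: ubeta => _];
    move=> /(congr1 (@^~ u)).
(* Both families share the index space of [T]; [Gam'] carries its second entry over to [S], and is
   onto by [GamK]. *)
pose I := ({w : 'I_d -> R[i] | unit_ball w} *
  hsum (codefect_space T) {ffun 'I_d -> defect_space T})%type.
pose g (i : I) := adj (agler_G S (sval i.1)) (Gam' i.2).
pose h (i : I) := adj (agler_G T (sval i.1)) i.2.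
have AS z := agler_G_adjoint S1 z; have AT z := agler_G_adjoint T1 z.
have [| | |U UU Ug] := @gram_unitary R I Xt X g h.
(* [<G(w)^* u, G(z)^* v>] equals [<K(z, w) u, v>]. *)
- move=> [[w wB] u] [[z zB] v]; rewrite /g /h /=.
  rewrite -(AS z zB) -(AT z zB) -GamA.
  have [_ /(congr1 (@^~ u)) KTS] := TS z w zB wB.
  exact: (congr1 (fun y => '[y, v]) (esym KTS)).
- move=> x gx; apply: (agler_G_total S1 sccS) => z zB.
  apply: inner_inj => v; rewrite inner0r -(GamK v) innerC (AS z zB).
  by have := gx (exist _ z zB, Gam v); rewrite /g /= => ->; exact: conjC0.
- move=> x hx; apply: (agler_G_total T1 sccT) => z zB.
  apply: inner_inj => v; rewrite inner0r innerC (AT z zB).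
  by have := hx (exist _ z zB, v); rewrite /h /= => ->; exact: conjC0.
exists U; split=> // i; apply: (component_intertwine T1 S1 ubeta UU) => //.
(* [Ug] reads [U^* G_T(z)^* = G_S(z)^* Gam^*]; this is the adjoint relation. *)
- move=> z x zB; apply: inner_inj => v; rewrite innerC [RHS]innerC.
  have -> : '[agler_G T z (U x), v] = '[x, adj (agler_G S z) (Gam' v)].
    by rewrite (AT z zB); exact: (Ug x (exist _ z zB, v)).
  by rewrite -(AS z zB) -GamA.
- move=> v; have [-> _] := TS _ _ (unit_ball0 R d) (unit_ball0 R d).
  by case: ubeta => _ /(congr1 (@^~ v)) /= ->.
Qed.
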